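(* Let $\Bbbk$ be an algebraically closed field of characteristic zero and let $H$ be an affine commutative Hopf $\Bbbk$-algebra which is connected as a Hopf algebra, so that $H=\Bbbk(U)$ is the coordinate algebra of a unipotent algebraic $\Bbbk$-group $U$. Then $H$ is coradically graded if and only if $U$ is a Carnot group.
   Context: For a coalgebra $H$, the coradical filtration $\{H_n\}$ has $H_0$ the coradical (sum of simple subcoalgebras) and $H_n=\Delta^{-1}(H\otimes H_0+H_{n-1}\otimes H)$; $H$ is connected as a Hopf algebra if $H_0=\Bbbk$. A graded Hopf algebra is a Hopf algebra with a decomposition $H=\bigoplus_{i\ge0}H(i)$ such that $H(i)H(j)\subseteq H(i+j)$, $S(H(i))\subseteq H(i)$ and $\Delta(H(i))\subseteq\bigoplus_{\ell}H(\ell)\otimes H(i-\ell)$; it is coradically graded if moreover $H_i=\bigoplus_{j\le i}H(j)$ for all $i\ge0$. ''$H$ is coradically graded'' means $H$ admits such a grading. A unipotent algebraic group $U$ is Carnot if its Lie algebra $\mathfrak{u}$ admits an $\mathbb{N}$-grading $\mathfrak{u}=\bigoplus_{i=1}^t\mathfrak{u}_i$ (as a Lie algebra) with $\mathfrak{u}$ generated by $\mathfrak{u}_1$. *)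

(* Defs.v *)
From HB Require Import structures.
From mathcomp Require Import all_boot all_order all_algebra.
Set Implicit Arguments. Unset Strict Implicit. Unset Printing Implicit Defensive.
Import GRing.Theory.
Local Open Scope ring_scope.

(* There is no tensor product of (infinite-dimensional)
   vector spaces in the library.  An element of H (x) H is represented by a
   finite list of pairs [(a_1,b_1);...;(a_m,b_m)] standing for
   sum_i a_i (x) b_i, and two such lists denote the same tensor iff they
   agree under every pair of linear functionals (f,g) (the canonical map
   H (x) H -> Bil(dual H, dual H) is injective over a field). *)

Section Hopf.
Variables (k : fieldType) (H : comAlgType k).

Definition lin_fun (f : H -> k) : Prop :=
  forall (a : k) (x y : H), f (a *: x + y) = a * f x + f y.

Definition tensor := seq (H * H).

Definition ev2 (f g : H -> k) (t : tensor) : k :=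
  \sum_(p <- t) f p.1 * g p.2.

Definition tensor_eq (t1 t2 : tensor) : Prop :=
  forall f g, lin_fun f -> lin_fun g -> ev2 f g t1 = ev2 f g t2.

Definition tmul (t1 t2 : tensor) : tensor :=
  [seq (p.1 * q.1, p.2 * q.2) | p <- t1, q <- t2].

Definition in_tensor (R : H -> H -> Prop) (t : tensor) : Prop :=
  exists s : tensor, tensor_eq s t /\ (forall p, p \in s -> R p.1 p.2).

Definition subsp (P : H -> Prop) : Prop :=
  P 0 /\ forall (a : k) x y, P x -> P y -> P (a *: x + y).

Variables (D : H -> tensor) (eps : H -> k) (S : H -> H).

Definition is_hopf : Prop :=
  (forall (a : k) x y,
         tensor_eq (D (a *: x + y)) ([seq (a *: p.1, p.2) | p <- D x] ++ D y)) /\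
      (forall x y, tensor_eq (D (x * y)) (tmul (D x) (D y))) /\
      tensor_eq (D 1) [:: (1, 1)] /\
      (* coassociativity, (D (x) id) D x = (id (x) D) D x tested on f(x)g(x)h *)
      (forall f g h, lin_fun f -> lin_fun g -> lin_fun h -> forall x,
         \sum_(p <- D x) ev2 f g (D p.1) * h p.2
         = \sum_(p <- D x) f p.1 * ev2 g h (D p.2)) /\
      (lin_fun eps /\ (forall x y, eps (x * y) = eps x * eps y) /\ eps 1 = 1) /\
      (forall x, \sum_(p <- D x) eps p.1 *: p.2 = x
              /\ \sum_(p <- D x) eps p.2 *: p.1 = x) /\
      (forall (a : k) x y, S (a *: x + y) = a *: S x + S y) /\
      (forall x, \sum_(p <- D x) S p.1 * p.2 = (eps x)%:A
              /\ \sum_(p <- D x) p.1 * S p.2 = (eps x)%:A).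

Definition affine_alg : Prop :=
  exists gens : seq H, forall P : H -> Prop,
    subsp P -> P 1 -> (forall x y, P x -> P y -> P (x * y)) ->
    (forall x, x \in gens -> P x) -> forall x, P x.

Definition subcoalg (C : H -> Prop) : Prop :=
  subsp C /\ forall x, C x -> in_tensor (fun a b => C a /\ C b) (D x).

Definition simple_subcoalg (C : H -> Prop) : Prop :=
  [/\ subcoalg C, (exists x, C x /\ x <> 0) &
      forall C', subcoalg C' -> (forall x, C' x -> C x) ->
        (exists x, C' x /\ x <> 0) -> forall x, C x -> C' x].

Definition coradical (x : H) : Prop :=
  exists s : seq H, x = \sum_(y <- s) y /\
    forall y, y \in s -> exists C, simple_subcoalg C /\ C y.

(* coradical filtration: H_{n+1} = D^{-1}(H (x) H_0 + H_n (x) H) *)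
Fixpoint corad_filt (n : nat) : H -> Prop :=
  match n with
  | 0 => coradical
  | n'.+1 => fun x => in_tensor (fun a b => coradical b \/ corad_filt n' a) (D x)
  end.

Definition connected : Prop := forall x, coradical x <-> exists c : k, x = c%:A.

Definition direct_decomp (Hg : nat -> H -> Prop) : Prop :=
  [/\ forall i, subsp (Hg i),
      (forall x, exists (N : nat) (xs : nat -> H),
          (forall i, Hg i (xs i)) /\ x = \sum_(i < N) xs i) &
      (forall (N : nat) (xs : nat -> H), (forall i, Hg i (xs i)) ->
          \sum_(i < N) xs i = 0 -> forall i, (i < N)%N -> xs i = 0)].

Definition graded_hopf (Hg : nat -> H -> Prop) : Prop :=
  [/\ direct_decomp Hg,
      (forall i j x y, Hg i x -> Hg j y -> Hg (i + j)%N (x * y)),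
      (forall i x, Hg i x -> Hg i (S x)) &
      (forall i x, Hg i x ->
         in_tensor (fun a b => exists l, (l <= i)%N /\ Hg l a /\ Hg (i - l)%N b)
                   (D x))].

Definition coradically_graded : Prop :=
  exists Hg : nat -> H -> Prop, graded_hopf Hg /\
    forall (i : nat) (x : H), corad_filt i x <->
      exists xs : nat -> H, (forall j, Hg j (xs j)) /\ x = \sum_(j < i.+1) xs j.

(* Lie algebra of U (H = k[U]): point derivations at the counit,
   Lie(U) = Der_eps(H, k), with bracket [d, e] = d*e - e*d (convolution) *)
Definition lie_elt (d : H -> k) : Prop :=
  lin_fun d /\ forall x y, d (x * y) = eps x * d y + d x * eps y.

Definition conv (d e : H -> k) : H -> k := fun x => ev2 d e (D x).

Definition lie_br (d e : H -> k) : H -> k := fun x => conv d e x - conv e d x.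

Definition lsubsp (P : (H -> k) -> Prop) : Prop :=
  P (fun _ => 0) /\ forall (a : k) d e, P d -> P e -> P (fun x => a * d x + e x).

Definition carnot : Prop :=
  exists (t : nat) (u : nat -> (H -> k) -> Prop),
  (forall i, lsubsp (u i) /\ (forall d, u i d -> lie_elt d)) /\
      (forall i, (i == 0)%N || (t < i)%N -> forall d, u i d -> forall x, d x = 0) /\
      (forall d, lie_elt d -> exists ds : nat -> H -> k,
          (forall i, u i (ds i)) /\ forall x, d x = \sum_(1 <= i < t.+1) ds i x) /\
      (forall ds : nat -> H -> k, (forall i, u i (ds i)) ->
          (forall x, \sum_(1 <= i < t.+1) ds i x = 0) ->
          forall i x, ds i x = 0) /\
      (forall i j d e, u i d -> u j e -> u (i + j)%N (lie_br d e)) /\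
      (forall P : (H -> k) -> Prop, lsubsp P ->
          (forall d e, P d -> P e -> P (lie_br d e)) ->
          (forall d, u 1%N d -> P d) -> forall d, lie_elt d -> P d).

End Hopf.

(* Main.v *)
Require Import Defs.
From HB Require Import structures.
From mathcomp Require Import all_boot all_order all_algebra.
From mathcomp Require Import boolp classical_sets ring.
Set Implicit Arguments. Unset Strict Implicit. Unset Printing Implicit Defensive.
Import GRing.Theory.
Local Open Scope ring_scope.

(** Work in the convolution algebra [A] of linear functionals on [H], with
    augmentation ideal [J] the functionals vanishing at [1].  When [H] is
    connected, every [x] is killed by some power of [J]: a minimal module on
    which [J] is not locally nilpotent would, by Burnside's theorem, have a
    simple coefficient coalgebra, hence a trivial one.

    If [H] is coradically graded, let [u_i] be the derivations living on [H(i)].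
    Primitive elements have degree at most one, so words in [u_1] separate the
    points of [H] and every [d] in [u_i] is a combination of words of length [i].
    The Dynkin operator [E * S], with [E] the degree map, turns a word into its
    iterated bracket and acts on [u_i] as multiplication by [i]; hence [u_1]
    generates.

    Conversely, [id^m] (convolution power) is polynomial in [m], and its linear
    coefficient [e] satisfies [id = exp e] and kills products of augmentation
    elements.  Dilating [e] by the grading of the Lie algebra and exponentiating
    gives maps of [H], polynomial in the dilation parameter, that scale every
    word in homogeneous derivations by its weight.  Their coefficients split [H]
    into the spaces [H(j)] orthogonal to the words of weight other than [j], and
    generation in degree one identifies the resulting filtration with the
    coradical one. *)

(** * Linear algebra without a basis *)

(** [H] is infinite-dimensional and a tensor is known only through pairs of functionals, so
    everything is pushed onto functionals: Zorn's lemma provides enough of them to separate points,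
    finite lists have finite coordinates, and words in derivations, which are primitive, play the
    part of the enveloping algebra. Local nilpotency of [J] makes logarithms and exponentials finite
    sums at each point. Algebraic closure enters there, through an eigenvalue in Burnside's theorem.
    The bound depends on the point, hence the truncation parameter [M] of [dilation]. An exponential
    controls only the powers of one derivation. Reaching arbitrary words is the obstacle of the
    converse: it takes polarization together with the fact that the dilation respects brackets.
    Coefficients are compared by evaluating at natural numbers, which uses characteristic zero, as
    do the divisions by factorials. Affineness gives finite dimension on the Lie side, since a
    derivation is determined by its values on generators. *)

Section LinearAlgebra.
Variables (k : fieldType).

Definition is_subspace (V : lmodType k) (P : V -> Prop) : Prop :=
  P 0 /\ forall (a : k) x y, P x -> P y -> P (a *: x + y).

Definition lin_of (V W : lmodType k) (f : V -> W) (lf : linear f) : {linear V -> W} :=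
  HB.pack f (GRing.isLinear.Build k V W *:%R f lf).

Section OneSpace.
Variables (V : lmodType k).
Implicit Types (P W : V -> Prop) (x y : V).

Lemma subspaceD P x y : is_subspace P -> P x -> P y -> P (x + y).
Proof. by move=> [_ sP] Px Py; rewrite -[x]scale1r; apply: sP. Qed.

Lemma subspaceZ P (a : k) x : is_subspace P -> P x -> P (a *: x).
Proof. by move=> [P0 sP] Px; rewrite -[_ *: _]addr0; apply: sP. Qed.

Lemma subspaceB P x y : is_subspace P -> P x -> P y -> P (x - y).
Proof.
move=> sP Px Py; apply: subspaceD => //.
by rewrite -scaleN1r; apply: subspaceZ.
Qed.

Lemma subspace_sum P (I : eqType) (r : seq I) (Q : pred I) (F : I -> V) :
  is_subspace P -> (forall i, i \in r -> Q i -> P (F i)) -> P (\sum_(i <- r | Q i) F i).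
Proof.
move=> sP PF; rewrite big_seq_cond; elim/big_ind: _ => [|x y|i /andP[ir Qi]].
- by case: sP.
- exact: subspaceD.
- exact: PF.
Qed.

(** A subspace maximal among those containing [W] and missing [x] has codimension one; the
    functional is the coefficient along [x]. *)
Lemma separation W x : is_subspace W -> ~ W x ->
  exists f : {linear V -> k^o}, (forall w, W w -> f w = 0) /\ f x = 1.
Proof.
move=> [W0 sW] nWx.
(* The union with [W] is built into [Q] because the empty chain has empty union, which must still
   satisfy [Q]. *)
pose Q (A : set V) := is_subspace (fun y => W y \/ A y) /\ ~ (W x \/ A x).
have [|A [[sA nAx] Amax]] := @Zorn_bigcup V Q.
  move=> F FQ Ftot; split; first split; first by left.
    move=> a y z [Wy|[X FX Xy]] [Wz|[Y FY Yz]].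
    - by left; apply: sW.
    - have [[_ /(_ a y z)] sY _] := FQ _ FY.
      by case: sY; [left|right|left|right; exists Y].
    - have [[_ /(_ a y z)] sY _] := FQ _ FX.
      by case: sY; [right|left|left|right; exists X].
    - have [XY|YX] := Ftot _ _ FX FY.
      + have [[_ /(_ a y z)] sY _] := FQ _ FY.
        by case: sY; [right; apply: XY|right|left|right; exists Y].
      + have [[_ /(_ a y z)] sY _] := FQ _ FX.
        by case: sY; [right|right; apply: YX|left|right; exists X].
  move=> [//|[X FX Xx]]; have [_] := FQ _ FX; apply; by right.
pose M y := W y \/ A y.
have sM : is_subspace M by exact: sA.
have nMx : ~ M x by exact: nAx.
have codim1 y : exists c, M (y - c *: x).
  have [My|nMy] := pselect (M y); first by exists 0; rewrite scale0r subr0.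
  pose B z := exists c, M (z - c *: y).
  have MB z : M z -> B z by exists 0; rewrite scale0r subr0.
  have sB : is_subspace (fun z => W z \/ B z).
    split; first by left.
    have BB z : W z \/ B z -> B z by move=> [Wz|//]; apply: MB; left.
    move=> a z1 z2 /BB[c1 h1] /BB[c2 h2]; right; exists (a * c1 + c2).
    rewrite scalerDl opprD -scalerA addrACA -scalerBr.
    by case: sM => _; apply.
  have [c Mc] : B x.
    have /Amax/not_andP[] : (A `<` B)%classic.
      split; first by move=> z Az; apply: MB; right.
      move=> /(_ y) BA; apply: nMy; right; apply: BA; exists 1.
      by rewrite scale1r subrr; case: sM.
    - by [].
    - move=> /contrapT [Wx|//]; by apply: MB; left.
  have c0 : c != 0 by apply/eqP => c0; move: Mc; rewrite c0 scale0r subr0.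
  exists c^-1.
  rewrite -[y - _]opprK opprB -scaleN1r; apply: (subspaceZ _ sM).
  have := subspaceZ c^-1 sM Mc; by rewrite scalerBr scalerA mulVf // scale1r.
pose f y : k^o := sval (cid (codim1 y)).
have fP y : M (y - f y *: x) by rewrite /f; case: cid.
have uniq_f y c : M (y - c *: x) -> f y = c.
  move=> Mc; apply/eqP; rewrite -subr_eq0; apply: contrapT => /negP fc.
  apply: nMx.
  have := subspaceZ (c - f y)^-1 sM (subspaceB sM (fP y) Mc).
  have -> : y - f y *: x - (y - c *: x) = (c - f y) *: x.
    by rewrite opprB addrC addrA subrK scalerBl.
  rewrite scalerA mulVf ?scale1r //.
  by rewrite -opprB oppr_eq0.
have lf : linear f.
  move=> a y z; apply: uniq_f.
  rewrite scalerDl opprD -scalerA addrACA -scalerBr.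
  by case: sM => _; apply.
exists (lin_of lf); split=> [w Ww|] /=; apply: uniq_f.
  by rewrite scale0r subr0; left.
by rewrite scale1r subrr; case: sM.
Qed.

Lemma functionals_separate x : (forall f : {linear V -> k^o}, f x = 0) -> x = 0.
Proof.
move=> h; apply: contrapT => x0.
have [|f [_ fx]] := @separation (fun y => y = 0) x _ x0.
  by split=> // a y z -> ->; rewrite scaler0 addr0.
by have := h f; rewrite fx => /eqP; rewrite oner_eq0.
Qed.

Lemma functionals_inj x y : (forall f : {linear V -> k^o}, f x = f y) -> x = y.
Proof.
move=> h; apply/eqP; rewrite -subr_eq0; apply/eqP/functionals_separate => f.
by rewrite linearB h subrr.
Qed.

(** A vector not yet reproduced adds its residue as a new [z], with a functional of the residue as
    coordinate. The [phi] live on all of [V], and the first clause keeps the [z] in any subspace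
    containing the list. *)
Lemma finite_coordinates (s : seq V) :
  exists (m : nat) (z : nat -> V) (phi : nat -> {linear V -> k^o}),
    (forall P, is_subspace P -> (forall a, a \in s -> P a) -> forall i, P (z i)) /\
    (forall a, a \in s -> a = \sum_(i < m) phi i a *: z i).
Proof.
elim: s => [|a s [m [z [phi [zP zE]]]]].
  exists 0%N, (fun=> 0), (fun=> \0); split=> // P [P0 _] _ _; exact: P0.
pose pr x := \sum_(i < m) phi i x *: z i.
have lpr : linear pr.
  move=> c x y; rewrite /pr scaler_sumr -big_split; apply: eq_bigr => i _ /=.
  by rewrite linearP scalerDl scalerA.
pose a' := a - pr a.
have zP' P : is_subspace P -> (forall b, b \in a :: s -> P b) -> forall i, P (z i).
  by move=> sP Ps; apply: zP => // b bs; apply: Ps; rewrite inE bs orbT.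
have [a'0|/eqP a'0] := eqVneq a' 0.
  exists m, z, phi; split=> // b; rewrite inE => /orP[/eqP ->|]; last exact: zE.
  by apply/eqP; rewrite -subr_eq0 -/(pr a) -/a' a'0.
have [|f [_ fa']] := @separation (fun y => y = 0) a' _ a'0.
  by split=> // c y t -> ->; rewrite scaler0 addr0.
have lg : linear (fun x => f (x - pr x)).
  by move=> c x y /=; rewrite lpr opprD addrACA -scalerBr linearP.
exists m.+1, (fun i => if (i < m)%N then z i else a'),
  (fun i => if (i < m)%N then phi i else lin_of lg); split.
  move=> P sP Ps i; case: ifP => _; first exact: zP'.
  apply: subspaceB => //; first by apply: Ps; rewrite inE eqxx.
  by apply: subspace_sum => // j _ _; apply: subspaceZ => //; apply: zP'.
move=> b bs; rewrite big_ord_recr /= ltnn /=.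
under eq_bigr => i _ do rewrite ltn_ord.
rewrite -/(pr b); move: bs; rewrite inE => /orP[/eqP ->|bs].
  by rewrite -/a' fa' scale1r addrC subrK.
by rewrite /pr -(zE _ bs) subrr linear0 scale0r addr0.
Qed.

Lemma functional_combination (n : nat) (w : 'I_n -> {linear V -> k^o}) (f : {linear V -> k^o}) :
  (forall x, (forall i, w i x = 0) -> f x = 0) ->
  exists c : 'I_n -> k, forall x, f x = \sum_(i < n) c i * w i x.
Proof.
elim: n w f => [|n IH] w f h.
  by exists (fun=> 0) => x; rewrite big_ord0; apply: h; case.
have [[x0 [w0 wx0]]|no] :=
  pselect (exists x, (forall i : 'I_n, w (lift ord0 i) x = 0) /\ w ord0 x <> 0).
  (* Subtracting [c0] times [w ord0] makes [f] vanish on the common kernel of the other functionals: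
     any point there can be moved along [x0] into the kernel of all of them. *)
  pose c0 := f x0 / w ord0 x0.
  have lg : linear (fun x => f x - c0 * w ord0 x : k^o).
    by move=> a x y /=; rewrite !linearP /= mulrDr -scalerAr opprD addrACA scalerBr.
  have [|c cE] := IH (fun i => w (lift ord0 i)) (lin_of lg).
    move=> x wx /=; pose b := w ord0 x / w ord0 x0.
    have wn : w ord0 x0 != 0 by apply/eqP.
    have fx : f (x - b *: x0) = 0.
      apply: h => i; rewrite linearB linearZ /=.
      case: (unliftP ord0 i) => [j ->|->].
        by rewrite wx w0 scaler0 subr0.
      by rewrite [X in _ - X](_ : _ = w ord0 x) ?subrr // /b; apply: (divfK wn).
    move: fx; rewrite linearB linearZ /= => /eqP; rewrite subr_eq0 => /eqP ->.
    have -> : b *: f x0 = c0 * w ord0 x.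
      by rewrite -[b *: _]/(b * _) /b /c0 mulrAC [RHS]mulrAC [f x0 * _]mulrC.
    by rewrite subrr.
  exists (fun i => oapp c c0 (unlift ord0 i)) => x.
  rewrite big_ord_recl unlift_none /=; under eq_bigr => i _ do rewrite liftK /=.
  by rewrite -cE /= addrC subrK.
have [|c cE] := IH (fun i => w (lift ord0 i)) f.
  move=> x wx; apply: h => i; case: (unliftP ord0 i) => [j ->|->] //.
  by apply: contrapT => wx0; apply: no; exists x.
exists (fun i => oapp c 0 (unlift ord0 i)) => x.
rewrite big_ord_recl unlift_none /= mul0r add0r cE.
by under [RHS]eq_bigr => i _ do rewrite liftK /=.
Qed.

End OneSpace.

(** Among matrices whose row space lies in [P], one of maximal rank must already absorb every vector
    of [P]. *)
Lemma row_subspaceP n (P : 'rV[k]_n -> Prop) : is_subspace P ->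
  exists U : 'M[k]_n, forall v, P v <-> (v <= U)%MS.
Proof.
move=> sP.
pose Q r := `[< exists U : 'M[k]_n, \rank U = r /\ forall v, (v <= U)%MS -> P v >].
have Q0 : exists r, Q r.
  exists 0%N; apply/asboolP; exists 0; split; first exact: mxrank0.
  by move=> v; rewrite submx0 => /eqP ->; case: sP.
have Qb r : Q r -> (r <= n)%N by move/asboolP => [U [<- _]]; exact: rank_leq_row.
case: (ex_maxnP Q0 Qb) => r /asboolP [U [rU UP]] rmax.
exists U => v; split=> [Pv|]; last exact: UP.
have := rmax (\rank (U + v)%MS); rewrite -rU => h.
have /h le : Q (\rank (U + v)%MS).
  apply/asboolP; exists (U + v)%MS; split=> // w /sub_addsmxP[[x y] /= ->].
  apply: subspaceD => //; first by apply: UP; apply: submxMl.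
  by rewrite [y]mx11_scalar mul_scalar_mx; apply: subspaceZ.
have := geq_leqif (mxrank_leqif_eq (addsmxSl U v)).
rewrite le => /esym/eqmxP eqU; rewrite eqU; exact: addsmxSr.
Qed.

End LinearAlgebra.

(** * Burnside's theorem for transitive matrix algebras *)

Section Burnside.
Variables (k : closedFieldType) (n : nat) (A : 'M[k]_n -> Prop).
Hypothesis A_sub : is_subspace A.
Hypothesis A_mul : forall x y, A x -> A y -> A (x *m y).
Hypothesis A_trans : forall v : 'rV[k]_n, v != 0 -> forall w, exists2 a, A a & v *m a = w.

Lemma closed_eigenvector m (X : 'M[k]_m) : (0 < m)%N ->
  exists (c : k) (u : 'rV[k]_m), u *m X = c *: u /\ u != 0.
Proof.
move=> m0.
have [c] : exists c, root (char_poly X) c.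
  by apply/closed_rootP; rewrite size_char_poly; case: (m) m0.
rewrite -eigenvalue_root_char => /eigenvalueP[u uX u0].
by exists c, u.
Qed.

(* Lomonosov-Rosenthal: an element of minimal positive rank has rank one, for
   otherwise cutting it down by an eigenvalue of [a *m T] on its row space
   produces a nonzero element of smaller rank. *)
Lemma rank_one_element : (0 < n)%N -> exists2 T, A T & \rank T = 1%N.
Proof.
move=> n0.
pose v0 : 'rV[k]_n := delta_mx 0 (Ordinal n0).
have v00 : v0 != 0.
  apply/eqP => /matrixP /(_ 0 (Ordinal n0)); rewrite !mxE !eqxx /= => /eqP.
  by rewrite oner_eq0.
pose Q r := `[< exists T, [/\ A T, T != 0 & \rank T = r] >].
have exQ : exists r, Q r.
  have [T AT vT] := A_trans v00 v0; exists (\rank T); apply/asboolP; exists T.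
  by split=> //; apply/eqP => T0; move: v00; rewrite -vT T0 mulmx0 eqxx.
case: (ex_minnP exQ) => r /asboolP[T [AT T0 rT]] rmin.
have r0 : (0 < r)%N by rewrite -rT lt0n mxrank_eq0.
have [r1|r2] := leqP r 1; first by exists T => //; apply/eqP; rewrite rT eqn_leq r1.
have [x1 x1T] : exists x1 : 'rV_n, x1 *m T != 0.
  have /rowV0Pn[v /submxP[x ->] v1] := T0; by exists x.
have [x2 x2T] : exists x2 : 'rV_n, ~~ (x2 *m T <= x1 *m T)%MS.
  apply: contrapT => no.
  have : (T <= x1 *m T)%MS.
    apply/row_subP => i; rewrite rowE; apply: contrapT => /negP h.
    by apply: no; exists (delta_mx 0 i).
  move/mxrankS; rewrite rT => h.
  by have := leq_trans r2 (leq_trans h (rank_leq_row _)).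
have [a Aa x1Ta] := A_trans x1T x2.
pose B := row_base T.
have sB : (B *m (a *m T) <= B)%MS by rewrite mulmxA eq_row_base submxMl.
have [X BX] := submxP sB.
have [c [u [uX u0]]] : exists (c : k) (u : 'rV[k]_(\rank T)), u *m X = c *: u /\ u != 0.
  by apply: closed_eigenvector; rewrite rT.
pose T' := T *m (a *m T) - c *: T.
have T'E : T' = T *m (a *m T - c%:M) by rewrite mulmxBr mul_mx_scalar.
have AT' : A T' by apply: subspaceB => //; [apply: A_mul => //; exact: A_mul|exact: subspaceZ].
have T'0 : T' != 0.
  apply/eqP => T'0; have : x1 *m T' = 0 by rewrite T'0 mulmx0.
  rewrite mulmxBr !mulmxA x1Ta -scalemxAr => /eqP; rewrite subr_eq0 => /eqP E.
  by move: x2T; rewrite E scalemx_sub.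
have : (\rank T' < r)%N.
  have := mxrank_mul_ker T (a *m T - c%:M); rewrite -T'E rT => <-.
  rewrite -addn1 leq_add2l lt0n mxrank_eq0; apply/rowV0Pn.
  exists (u *m B).
    rewrite sub_capmx; apply/andP; split.
      by rewrite (submx_trans (submxMl _ _)) // eq_row_base.
    apply/sub_kermxP; rewrite mulmxBr -mulmxA BX mulmxA uX -scalemxAl.
    by rewrite mul_mx_scalar subrr.
  have fB := row_base_free T; apply/eqP => uB0.
  by move: u0; rewrite -(mulmxKp fB u) uB0 mul0mx eqxx.
rewrite ltnNge rmin //; apply/asboolP; by exists T'.
Qed.

(** Take [T = u *m v] of rank one in [A]. Transitivity yields every [v *m a]; the columns [a *m u]
    also fill the space, since a nonzero row orthogonal to all of them would contradict
    transitivity. Products give all rank-one matrices, and matrix units span. *)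
Lemma burnside X : A X.
Proof.
have [n0|n0] := posnP n.
  have -> : X = 0.
    by apply/matrixP => i; have := leq_trans (ltn_ord i) (eq_leq n0); rewrite ltn0.
  by case: A_sub.
have [T AT rT] := rank_one_element n0.
have T0 : T != 0 by rewrite -mxrank_eq0 rT.
have [u [v [Tuv u0 v0]]] : exists (u : 'cV[k]_n) (v : 'rV[k]_n), [/\ T = u *m v, u != 0 & v != 0].
  have := mulmx_base T; move: (col_base T) (row_base T); rewrite rT => u v uv.
  exists u, v; split; rewrite -?uv //.
    by apply/eqP => u0; move: T0; rewrite -uv u0 mul0mx eqxx.
  by apply/eqP => v0; move: T0; rewrite -uv v0 mulmx0 eqxx.
pose Q (p : 'rV[k]_n) := exists2 a, A a & p = (a *m u)^T.
have sQ : is_subspace Q.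
  split; first by exists 0; [case: A_sub|rewrite mul0mx trmx0].
  move=> c p q [a Aa ->] [b Ab ->]; exists (c *: a + b).
    by case: A_sub => _; apply.
  by rewrite mulmxDl -scalemxAl linearP.
have [U UP] := row_subspaceP sQ.
have full : \rank U = n.
  apply/eqP; rewrite eqn_leq rank_leq_row /= leqNgt; apply/negP => rU.
  have : kermx U^T != 0 by rewrite -mxrank_eq0 mxrank_ker mxrank_tr subn_eq0 -ltnNge.
  move=> /rowV0Pn[r rK r0].
  have {}rK : r *m U^T = 0 by apply/sub_kermxP.
  have ra a : A a -> r *m a *m u = 0.
    move=> Aa; have /UP/submxP[y] : Q (a *m u)^T by exists a.
    move/(congr1 trmx); rewrite trmxK trmx_mul => e.
    by rewrite -mulmxA e mulmxA rK mul0mx.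
  have [i ui] : exists i, u i 0 != 0.
    apply: contrapT => no; move: u0 => /eqP; apply; apply/matrixP => i j.
    rewrite ord1 !mxE; apply/eqP; apply: contrapT => /negP h; apply: no; by exists i.
  have [a Aa raE] := A_trans r0 (delta_mx 0 i).
  have := ra _ Aa; rewrite raE -rowE => /matrixP /(_ 0 0); rewrite !mxE => ui0.
  by rewrite ui0 eqxx in ui.
have rank1 (p : 'cV[k]_n) (q : 'rV[k]_n) : A (p *m q).
  have /UP[a Aa /trmx_inj ->] : (p^T <= U)%MS.
    by apply: submx_full; rewrite /row_full full.
  have [b Ab <-] := A_trans v0 q.
  rewrite -mulmxA (mulmxA u) -Tuv; apply: A_mul => //; exact: A_mul.
rewrite (matrix_sum_delta X).
apply: subspace_sum => // i _ _; apply: subspace_sum => // j _ _.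
apply: subspaceZ => //; by rewrite -(mul_delta_mx (0 : 'I_1)); apply: rank1.
Qed.

End Burnside.

(** * Polynomial identities and polarization in characteristic zero *)

Section CharZero.
Variable k : fieldType.
Hypothesis char0 : [pchar k] =i pred0.

Lemma natr_neq0 n : (0 < n)%N -> n%:R != 0 :> k.
Proof. by move=> n0; rewrite ((pcharf0P k).1 char0) -lt0n. Qed.

Lemma natr_k_inj : injective (fun n : nat => n%:R : k).
Proof.
have wlg m n : (m <= n)%N -> m%:R = n%:R :> k -> m = n.
  move=> le e; apply/eqP; rewrite eqn_leq le /= -subn_eq0 eqn0Ngt; apply/negP.
  by move/natr_neq0; rewrite natrB // e subrr eqxx.
move=> m n; have [le|/ltnW le] := leqP m n; first exact: wlg.
by move=> /esym/wlg ->.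
Qed.

Lemma poly_nat_eq0 (p : {poly k}) : (forall m : nat, p.[m%:R] = 0) -> p = 0.
Proof.
move=> h; apply/eqP; apply: contrapT => /negP p0.
have := @max_poly_roots _ p [seq i%:R | i <- iota 0 (size p)] p0.
rewrite size_map size_iota ltnn map_inj_uniq ?iota_uniq; last exact: natr_k_inj.
suff -> : all (root p) [seq i%:R | i <- iota 0 (size p)] by move/(_ isT isT).
by apply/allP => _ /mapP[i _ ->]; apply/rootP.
Qed.

(** Roots cannot be counted in [H], which may have zero divisors; applying a functional to the
    coefficients reduces to scalar polynomials. *)
Lemma poly_alg_nat_eq0 (H : comAlgType k) (p : {poly H}) :
  (forall m : nat, p.[m%:R] = 0) -> p = 0.
Proof.
move=> h; apply/polyP => j; rewrite coef0; apply: (@functionals_separate k H) => f.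
pose q := \poly_(i < size p) (f p`_i : k).
have q0 : q = 0.
  apply: poly_nat_eq0 => m; rewrite horner_poly.
  have := congr1 f (h m); rewrite horner_coef linear_sum linear0; apply: etrans.
  apply: eq_bigr => i _; rewrite -!natrX !mulr_natr.
  by rewrite linearMn.
have := congr1 (fun r : {poly k} => r`_j) q0; rewrite coef_poly coef0.
by case: ltnP => // hj _; rewrite nth_default // linear0.
Qed.

Lemma poly_alg_nat_inj (H : comAlgType k) (p q : {poly H}) :
  (forall m : nat, p.[m%:R] = q.[m%:R]) -> p = q.
Proof.
move=> h; apply/eqP; rewrite -subr_eq0; apply/eqP/poly_alg_nat_eq0 => m.
by rewrite hornerD hornerN h subrr.
Qed.

(* Polarization: the linear coefficient in [c] of [G] at [x + c y] repeated
   [q] times is [q] times the value with one [y] inserted. *)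
Lemma symmetric_multilinear_eq0 (V : lmodType k) (P : V -> Prop) (r : nat) (G : seq V -> k) :
  is_subspace P ->
  (forall s1 s2 c x y, (size s1 + size s2).+1 = r -> (forall v, v \in s1 -> P v) ->
     (forall v, v \in s2 -> P v) -> P x -> P y ->
     G (s1 ++ (c *: x + y) :: s2) = c * G (s1 ++ x :: s2) + G (s1 ++ y :: s2)) ->
  (forall s1 s2 x y, (size s1 + size s2).+2 = r -> (forall v, v \in s1 -> P v) ->
     (forall v, v \in s2 -> P v) -> P x -> P y ->
     G (s1 ++ x :: y :: s2) = G (s1 ++ y :: x :: s2)) ->
  (forall x, P x -> G (nseq r x) = 0) ->
  forall s, size s = r -> (forall v, v \in s -> P v) -> G s = 0.
Proof.
move=> sP lin sym diag.
have Pnseq q x : P x -> forall v, v \in nseq q x -> P v.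
  by move=> Px v; rewrite mem_nseq => /andP[_ /eqP ->].
have Pcons x (s : seq V) : P x -> (forall v, v \in s -> P v) -> forall v, v \in x :: s -> P v.
  by move=> Px Ps v; rewrite inE => /orP[/eqP ->|/Ps].
(* Induction on the number of letters other than the repeated [x]; with none left, the hypothesis on
   powers applies. *)
suff main p s x : (p + size s)%N = r -> P x -> (forall v, v \in s -> P v) ->
    G (nseq p x ++ s) = 0.
  move=> s ss Ps; have P0 : P 0 by case: sP.
  by apply: (main 0%N s 0).
move: {2}(size s) (leqnn (size s)) => d; elim: d p s x => [|d IH] p s x.
  rewrite leqn0 size_eq0 => /eqP ->; rewrite addn0 cats0 => -> Px _; exact: diag.
case: s => [_|y s]; first by rewrite addn0 cats0 => -> Px _; exact: diag.
rewrite ltnS => sd pr Px Pys.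
have Py : P y by apply: Pys; rewrite inE eqxx.
have Ps v : v \in s -> P v by move=> vs; apply: Pys; rewrite inE vs orbT.
pose fix pol (q : nat) (v : seq V) {struct q} : {poly k} :=
  if q is q'.+1 then pol q' (x :: v) + 'X * pol q' (y :: v) else (G v)%:P.
have Pxy c : P (c *: y + x) by case: sP => _; apply.
have polE c q v : (q + size v)%N = r -> (forall t, t \in v -> P t) ->
    (pol q v).[c] = G (nseq q (c *: y + x) ++ v).
  elim: q v => [|q IHq] v qr Pv /=; first by rewrite hornerC.
  rewrite hornerD mulrC hornerMX.
  rewrite !IHq //=; try (by rewrite addnS -addSn); try exact: Pcons.
  rewrite -cat_cons -[_ :: nseq _ _]/(nseq q.+1 _) -addn1 nseqD -catA /=.
  rewrite lin //; last exact: Pnseq.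
    by rewrite addrC mulrC.
  by rewrite size_nseq -addSn.
have pol0 q v : (pol q v)`_0 = G (nseq q x ++ v).
  elim: q v => [|q IHq] v /=; first by rewrite coefC.
  rewrite coefD coefXM addr0 IHq -cat_cons -[_ :: nseq _ _]/(nseq q.+1 _).
  by rewrite -addn1 nseqD -catA.
have pol1 q v : (q.+1 + size v)%N = r -> (forall t, t \in v -> P t) ->
    (pol q.+1 v)`_1 = q.+1%:R * G (nseq q x ++ y :: v).
  elim: q v => [|q IHq] v qr Pv.
    by rewrite /= coefD coefXM !coefC /= add0r mul1r.
  rewrite -[pol _ _]/(pol q.+1 (x :: v) + 'X * pol q.+1 (y :: v)) coefD coefXM.
  rewrite pol0 IHq; last exact: Pcons; last by rewrite /= addnS -addSn.
  rewrite sym //; last exact: Pnseq; last by rewrite size_nseq; move: qr; rewrite !addSn.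
  rewrite (_ : nseq q x ++ x :: y :: v = nseq q.+1 x ++ y :: v).
    by rewrite -[q.+2%:R]natr1 mulrDl mul1r.
  by rewrite -addn1 nseqD -catA.
have : pol p.+1 s = 0.
  apply: poly_nat_eq0 => m; rewrite polE //; last by rewrite -pr addSnnS.
  by apply: IH => //; rewrite -pr addSnnS.
move/(congr1 (fun q : {poly k} => q`_1)); rewrite pol1 //; last by rewrite -pr addSnnS.
by rewrite coef0 => /eqP; rewrite mulf_eq0 (negPf (natr_neq0 _)) //= => /eqP.
Qed.

End CharZero.

(** * The convolution algebra *)

Section Tensor.
Variables (k : fieldType) (H : comAlgType k).

Definition bilin (W : lmodType k) (B : H -> H -> W) : Prop :=
  (forall y, linear (B^~ y)) /\ (forall x, linear (B x)).

Lemma sum_lin (V W : lmodType k) (f : V -> W) (I : Type) (r : seq I) (c : I -> k) (F : I -> V) :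
  linear f -> f (\sum_(i <- r) c i *: F i) = \sum_(i <- r) c i *: f (F i).
Proof.
move=> lf; rewrite -[f]/(lin_of lf : V -> W) linear_sum.
by apply: eq_bigr => i _; rewrite linearZ.
Qed.

(** Equality against scalar functionals upgrades to all bilinear maps: once the first legs are
    expanded in finite coordinates, the collected second legs agree because functionals separate
    points. *)
Lemma tensor_bilin (W : lmodType k) (B : H -> H -> W) (t1 t2 : tensor H) :
  bilin B -> tensor_eq t1 t2 -> \sum_(p <- t1) B p.1 p.2 = \sum_(p <- t2) B p.1 p.2.
Proof.
move=> [B1 B2] e.
have [m [z [phi [_ zE]]]] := finite_coordinates [seq p.1 | p <- t1 ++ t2].
have main t : {subset t <= t1 ++ t2} ->
    \sum_(p <- t) B p.1 p.2 = \sum_(i < m) B (z i) (\sum_(p <- t) phi i p.1 *: p.2).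
  move=> st; under [RHS]eq_bigr => i _ do rewrite sum_lin //.
  rewrite exchange_big /= big_seq [RHS]big_seq; apply: eq_bigr => p pt.
  by rewrite {1}(zE p.1) ?(sum_lin _ _ _ (B1 _)) //; apply/map_f/st.
rewrite !main; try by move=> p pt; rewrite mem_cat pt ?orbT.
apply: eq_bigr => i _; congr (B _ _); apply: functionals_inj => f.
rewrite !linear_sum.
have := e (phi i) f (fun a x y => linearP (phi i) a x y) (fun a x y => linearP f a x y).
rewrite /ev2 => E.
transitivity (\sum_(p <- t1) phi i p.1 * f p.2); first by apply: eq_bigr => p _; rewrite linearZ.
rewrite [LHS]E; by apply: eq_bigr => p _; rewrite linearZ.
Qed.

End Tensor.

Section Convolution.
Variables (k : fieldType) (H : comAlgType k).
Variables (D : H -> seq (H * H)) (eps : H -> k) (S : H -> H).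
Hypothesis h : is_hopf D eps S.

Lemma eps_lin : lin_fun eps. Proof. by case: h => ? [? [? [? [[? ?] ?]]]]. Qed.
Lemma epsM x y : eps (x * y) = eps x * eps y.
Proof. by case: h => ? [? [? [? [[? [? ?]] ?]]]]. Qed.
Lemma eps1 : eps 1 = 1. Proof. by case: h => ? [? [? [? [[? [? ?]] ?]]]]. Qed.

Lemma counitl x : \sum_(p <- D x) eps p.1 *: p.2 = x.
Proof. by case: h => ? [? [? [? [? [/(_ x)[-> _] _]]]]]. Qed.
Lemma counitr x : \sum_(p <- D x) eps p.2 *: p.1 = x.
Proof. by case: h => ? [? [? [? [? [/(_ x)[_ ->] _]]]]]. Qed.

Lemma S_lin : linear S.
Proof. by case: h => ? [? [? [? [? [? [? ?]]]]]]. Qed.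
Lemma antipodel x : \sum_(p <- D x) S p.1 * p.2 = (eps x)%:A.
Proof. by case: h => ? [? [? [? [? [? [? /(_ x)[-> _]]]]]]]. Qed.

Section DSum.
Variables (W : lmodType k).
Definition dsum (B : H -> H -> W) x := \sum_(p <- D x) B p.1 p.2.

Lemma dsum_lin B : bilin B -> linear (dsum B).
Proof.
move=> bB a x y; rewrite /dsum.
have [/(_ a x y) e _] := h; rewrite (tensor_bilin bB e) big_cat big_map; congr (_ + _).
rewrite scaler_sumr; apply: eq_bigr => p _ /=.
by have /(_ p.2) lB := bB.1; rewrite -[B _ _]/(lin_of lB _) linearZ.
Qed.

Lemma dsumM B x y : bilin B ->
  dsum B (x * y) = \sum_(p <- D x) \sum_(q <- D y) B (p.1 * q.1) (p.2 * q.2).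
Proof.
move=> bB; have [_ [/(_ x y) e _]] := h.
by rewrite /dsum (tensor_bilin bB e) /tmul big_allpairs_dep.
Qed.

Lemma dsum_1 B : bilin B -> dsum B 1 = B 1 1.
Proof.
move=> bB; have [_ [_ [e _]]] := h.
by rewrite /dsum (tensor_bilin bB e) big_seq1.
Qed.

(** Coassociativity is assumed only on triples of functionals; expanding all three legs in finite
    coordinates carries it to any trilinear [T]. *)
Lemma dsum_coassoc (T : H -> H -> H -> W) x :
  (forall b c, linear (fun a => T a b c)) -> (forall a c, linear (fun b => T a b c)) ->
  (forall a b, linear (fun c => T a b c)) ->
  \sum_(p <- D x) \sum_(q <- D p.1) T q.1 q.2 p.2 =
  \sum_(p <- D x) \sum_(q <- D p.2) T p.1 q.1 q.2.
Proof.
move=> T1 T2 T3.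
pose t1 := [seq (q.1, q.2, p.2) | p <- D x, q <- D p.1].
pose t2 := [seq (p.1, q.1, q.2) | p <- D x, q <- D p.2].
have [m [z [phi [_ zE]]]] := finite_coordinates
  (flatten [seq [:: u.1.1; u.1.2; u.2] | u <- t1 ++ t2]).
have co u v : u \in t1 ++ t2 -> v \in [:: u.1.1; u.1.2; u.2] ->
    v = \sum_(i < m) phi i v *: z i.
  move=> ut vu; apply: zE; apply/flattenP; exists [:: u.1.1; u.1.2; u.2] => //.
  by apply/mapP; exists u.
have main t : {subset t <= t1 ++ t2} ->
   \sum_(u <- t) T u.1.1 u.1.2 u.2 = \sum_(i < m) \sum_(j < m) \sum_(l < m)
     (\sum_(u <- t) phi i u.1.1 * phi j u.1.2 * phi l u.2) *: T (z i) (z j) (z l).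
  move=> st.
  under [RHS]eq_bigr => i _.
    under eq_bigr => j _ do (under eq_bigr => l _ do rewrite scaler_suml; rewrite exchange_big /=).
    rewrite exchange_big /=; over.
  rewrite exchange_big /= big_seq [RHS]big_seq; apply: eq_bigr => u ut.
  have cu := co _ _ (st _ ut).
  rewrite {1}(cu u.1.1) ?inE ?eqxx // (sum_lin _ _ _ (T1 _ _)); apply: eq_bigr => i _.
  rewrite {1}(cu u.1.2) ?inE ?eqxx ?orbT // (sum_lin _ _ _ (T2 _ _)) scaler_sumr.
  apply: eq_bigr => j _.
  rewrite {1}(cu u.2) ?inE ?eqxx ?orbT // (sum_lin _ _ _ (T3 _ _)) !scaler_sumr.
  by apply: eq_bigr => l _; rewrite !scalerA.
transitivity (\sum_(u <- t1) T u.1.1 u.1.2 u.2); first by rewrite big_allpairs_dep.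
transitivity (\sum_(u <- t2) T u.1.1 u.1.2 u.2); last by rewrite big_allpairs_dep.
rewrite !main; try by move=> u ut; rewrite mem_cat ut ?orbT.
apply: eq_bigr => i _; apply: eq_bigr => j _; apply: eq_bigr => l _; congr (_ *: _).
rewrite !big_allpairs_dep /=.
have [_ [_ [_ [/(_ (phi i) (phi j) (phi l))]]]] := h.
have lp n : lin_fun (phi n) by move=> a y1 y2; rewrite linearP.
move=> /(_ (lp i) (lp j) (lp l) x) E _; rewrite /ev2 in E.
transitivity (\sum_(p <- D x) (\sum_(p0 <- D p.1) phi i p0.1 * phi j p0.2) * phi l p.2).
  by apply: eq_bigr => p _; rewrite mulr_suml.
rewrite [LHS]E; apply: eq_bigr => p _; rewrite mulr_sumr.
by apply: eq_bigr => q _; rewrite mulrA.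
Qed.

End DSum.

(* Linear maps from [H] to a commutative algebra [R], made into an algebra by
   convolution.  The index [h] carries the Hopf axioms that the algebra
   structure depends on. *)
Record cvmap (R : comAlgType k) (hh : is_hopf D eps S) :=
  CVMap { cvfun :> H -> R; cvfun_lin : linear cvfun }.

End Convolution.

Arguments CVMap {k H D eps S R} hh cvfun cvfun_lin.

Section ConvolutionAlgebra.
Variables (k : fieldType) (H : comAlgType k).
Variables (D : H -> seq (H * H)) (eps : H -> k) (S : H -> H).
Variables (h : is_hopf D eps S) (R : comAlgType k).
Local Notation E := (cvmap R h).

HB.instance Definition _ := gen_eqMixin E.
HB.instance Definition _ := gen_choiceMixin E.
HB.instance Definition _ (f : E) := GRing.isLinear.Build k H R *:%R (cvfun f) (cvfun_lin f).

Lemma cvP (f g : E) : f =1 g -> f = g.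
Proof.
case: f g => f lf [g lg] /= /funext e.
by case: g / e in lg *; rewrite (Prop_irrelevance lf lg).
Qed.

Fact cvadd_lin (f g : E) : linear (fun x => f x + g x).
Proof. by move=> a x y; rewrite !linearP scalerDr addrACA. Qed.
Fact cvopp_lin (f : E) : linear (fun x => - f x).
Proof. by move=> a x y; rewrite [f _]linearP opprD scalerN. Qed.
Fact cvzero_lin : linear (fun _ : H => 0 : R).
Proof. by move=> a x y; rewrite scaler0 addr0. Qed.
Fact cvscale_lin (c : k) (f : E) : linear (fun x => c *: f x).
Proof. by move=> a x y; rewrite [f _]linearP scalerDr !scalerA mulrC. Qed.
Fact cvone_lin : linear (fun x : H => (eps x)%:A : R).
Proof. by move=> a x y; rewrite (eps_lin h) scalerDl scalerA. Qed.

Lemma bilinM (f g : E) : bilin (fun a b => f a * g b).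
Proof.
split=> x a y z; first by rewrite linearP mulrDl scalerAl.
by rewrite linearP mulrDr scalerAr.
Qed.
Definition cvmul_lin (f g : E) := dsum_lin h (bilinM f g).

Definition cvadd (f g : E) : E := CVMap h _ (cvadd_lin f g).
Definition cvopp (f : E) : E := CVMap h _ (cvopp_lin f).
Definition cvzero : E := CVMap h _ cvzero_lin.
Definition cvscale (c : k) (f : E) : E := CVMap h _ (cvscale_lin c f).
Definition cvone : E := CVMap h _ cvone_lin.
Definition cvmul (f g : E) : E := CVMap h _ (cvmul_lin f g).

Fact cvaddA : associative cvadd.
Proof. by move=> f g l; apply: cvP => x /=; rewrite addrA. Qed.
Fact cvaddC : commutative cvadd.
Proof. by move=> f g; apply: cvP => x /=; rewrite addrC. Qed.
Fact cvadd0 : left_id cvzero cvadd.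
Proof. by move=> f; apply: cvP => x /=; rewrite add0r. Qed.
Fact cvaddN : left_inverse cvzero cvopp cvadd.
Proof. by move=> f; apply: cvP => x /=; rewrite addNr. Qed.
HB.instance Definition _ := GRing.isZmodule.Build E cvaddA cvaddC cvadd0 cvaddN.

Fact cvmulA : associative cvmul.
Proof.
move=> f g l; apply: cvP => x /=; rewrite /dsum /=.
transitivity (\sum_(p <- D x) \sum_(q <- D p.2) f p.1 * g q.1 * l q.2).
  by apply: eq_bigr => p _; rewrite /dsum mulr_sumr; apply: eq_bigr => q _; rewrite mulrA.
rewrite -(dsum_coassoc h (T := fun a b c => f a * g b * l c)).
- by apply: eq_bigr => p _; rewrite /dsum mulr_suml.
- by move=> b c a y z; rewrite linearP !mulrDl !scalerAl.
- by move=> b c a y z; rewrite linearP mulrDr mulrDl scalerAl scalerAr.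
- by move=> b c a y z; rewrite linearP mulrDr scalerAr.
Qed.
Fact cvmul1 : left_id cvone cvmul.
Proof.
move=> f; apply: cvP => x /=; rewrite /dsum /= -[in RHS](counitl h x) linear_sum.
by apply: eq_bigr => p _; rewrite linearZ mulr_algl.
Qed.
Fact cvmulr1 : right_id cvone cvmul.
Proof.
move=> f; apply: cvP => x /=; rewrite /dsum /= -[in RHS](counitr h x) linear_sum.
by apply: eq_bigr => p _; rewrite linearZ mulr_algr.
Qed.
Fact cvmulDl : left_distributive cvmul cvadd.
Proof.
move=> f g l; apply: cvP => x /=; rewrite /dsum -big_split.
by apply: eq_bigr => p _; rewrite mulrDl.
Qed.
Fact cvmulDr : right_distributive cvmul cvadd.
Proof.
move=> f g l; apply: cvP => x /=; rewrite /dsum -big_split.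
by apply: eq_bigr => p _; rewrite mulrDr.
Qed.
Fact cvone_neq0 : cvone != cvzero.
Proof.
apply/eqP => /(congr1 (fun f : E => f 1)) /= /eqP.
by rewrite (eps1 h) scale1r oner_eq0.
Qed.
HB.instance Definition _ := GRing.Zmodule_isNzRing.Build E
  cvmulA cvmul1 cvmulr1 cvmulDl cvmulDr cvone_neq0.

Fact cvscaleA a b (f : E) : cvscale a (cvscale b f) = cvscale (a * b) f.
Proof. by apply: cvP => x /=; rewrite scalerA. Qed.
Fact cvscale1 : left_id 1 cvscale.
Proof. by move=> f; apply: cvP => x /=; rewrite scale1r. Qed.
Fact cvscaleDr : right_distributive cvscale +%R.
Proof. by move=> a f g; apply: cvP => x /=; rewrite scalerDr. Qed.
Fact cvscaleDl (f : E) : {morph cvscale^~ f : a b / a + b}.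
Proof. by move=> a b; apply: cvP => x /=; rewrite scalerDl. Qed.
HB.instance Definition _ := GRing.Zmodule_isLmodule.Build k E
  cvscaleA cvscale1 cvscaleDr cvscaleDl.

Fact cvscaleAl (a : k) (f g : E) : a *: (f * g) = (a *: f) * g.
Proof.
apply: cvP => x /=; rewrite /dsum scaler_sumr; apply: eq_bigr => p _.
by rewrite /= scalerAl.
Qed.
HB.instance Definition _ := GRing.Lmodule_isLalgebra.Build k E cvscaleAl.
Fact cvscaleAr (a : k) (f g : E) : a *: (f * g) = f * (a *: g).
Proof.
apply: cvP => x /=; rewrite /dsum scaler_sumr; apply: eq_bigr => p _.
by rewrite /= scalerAr.
Qed.
HB.instance Definition _ := GRing.Lalgebra_isAlgebra.Build k E cvscaleAr.

Lemma cvME (f g : E) x : (f * g) x = \sum_(p <- D x) f p.1 * g p.2.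
Proof. by []. Qed.
Lemma cvDE (f g : E) x : (f + g) x = f x + g x. Proof. by []. Qed.
Lemma cvNE (f : E) x : (- f) x = - f x. Proof. by []. Qed.
Lemma cvZE a (f : E) x : (a *: f) x = a *: f x. Proof. by []. Qed.
Lemma cv1E x : (1 : E) x = (eps x)%:A. Proof. by []. Qed.
Lemma cv0E x : (0 : E) x = 0. Proof. by []. Qed.
Lemma cv_sumE (I : Type) (r : seq I) (P : pred I) (F : I -> E) x :
  (\sum_(i <- r | P i) F i) x = \sum_(i <- r | P i) F i x.
Proof. by elim/big_rec2: _ => // i u v _ <-. Qed.

Lemma cvM_1 (f g : E) : (f * g) 1 = f 1 * g 1.
Proof. exact: (dsum_1 h (bilinM f g)). Qed.

Lemma CVMapE f (lf : linear f) x : CVMap h f lf x = f x :> R.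
Proof. by []. Qed.

End ConvolutionAlgebra.

Arguments cvfun : simpl never.

(** * The dual algebra, translates, and orthogonals of powers of the augmentation ideal *)

Section DualAlgebra.
Variables (k : fieldType) (H : comAlgType k).
Variables (D : H -> seq (H * H)) (eps : H -> k) (S : H -> H).
Variables (h : is_hopf D eps S).
Local Notation A := (cvmap k^o h).

Definition dual_of (f : H -> k) (lf : lin_fun f) : A := CVMap h (f : H -> k^o) lf.
Definition dual_lin (f : {linear H -> k^o}) : A := CVMap h f (fun a x y => linearP f a x y).

Lemma dual_inj x y : (forall f : A, f x = f y) -> x = y.
Proof. by move=> e; apply: (@functionals_inj k) => f; exact: (e (dual_lin f)). Qed.

Lemma dual_separation (W : H -> Prop) x : is_subspace W -> ~ W x ->
  exists f : A, (forall w, W w -> f w = 0) /\ f x = 1.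
Proof. by move=> sW /(separation sW)[f fP]; exists (dual_lin f). Qed.

Lemma cv1k x : (1 : A) x = eps x.
Proof. by rewrite cv1E; apply: mulr1. Qed.

Lemma epsA (c : k) : eps c%:A = c.
Proof. by rewrite -cv1k linearZ /= cv1k (eps1 h); apply: mulr1. Qed.

Lemma tensor_eqP (t1 t2 : tensor H) :
  (forall f g : A, \sum_(p <- t1) f p.1 * g p.2 = \sum_(p <- t2) f p.1 * g p.2) ->
  tensor_eq t1 t2.
Proof. by move=> e f g lf lg; exact: (e (dual_of lf) (dual_of lg)). Qed.

Lemma in_tensor_conv (R : H -> H -> Prop) x : in_tensor R (D x) ->
  exists s : seq (H * H), (forall p, p \in s -> R p.1 p.2) /\
    forall (W : lmodType k) (B : H -> H -> W), bilin B ->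
      dsum D B x = \sum_(p <- s) B p.1 p.2.
Proof.
move=> [s [e sR]]; exists s; split=> // W B bB.
by rewrite (tensor_bilin bB e).
Qed.

Lemma bilin_scaler (f : A) : bilin (fun a b : H => f b *: a).
Proof.
split=> x a y z; first by rewrite scalerDr !scalerA mulrC.
by rewrite linearP scalerDl scalerA.
Qed.
Lemma bilin_scalel (f : A) : bilin (fun a b : H => f a *: b).
Proof.
split=> x a y z; last by rewrite scalerDr !scalerA mulrC.
by rewrite linearP scalerDl scalerA.
Qed.

(** [rtrans f] and [ltrans f] are the transposes of right and left multiplication by [f] in the dual
    algebra, so a product of functionals evaluated at [x] can be peeled from either end. *)
Definition rtrans (f : A) : H -> H := dsum D (fun a b => f b *: a).
Definition ltrans (f : A) : H -> H := dsum D (fun a b => f a *: b).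

Lemma rtrans_lin f : linear (rtrans f). Proof. exact: (dsum_lin h (bilin_scaler f)). Qed.
Lemma ltrans_lin f : linear (ltrans f). Proof. exact: (dsum_lin h (bilin_scalel f)). Qed.
HB.instance Definition _ f := GRing.isLinear.Build k H H *:%R (rtrans f) (rtrans_lin f).
HB.instance Definition _ f := GRing.isLinear.Build k H H *:%R (ltrans f) (ltrans_lin f).

Lemma cv_rtrans (g f : A) x : g (rtrans f x) = (g * f) x.
Proof.
rewrite /rtrans /dsum linear_sum cvME; apply: eq_bigr => p _.
by rewrite linearZ; exact: mulrC.
Qed.
Lemma cv_ltrans (g f : A) x : g (ltrans f x) = (f * g) x.
Proof. by rewrite /ltrans /dsum linear_sum cvME; apply: eq_bigr => p _; rewrite linearZ. Qed.

Lemma rtransM (f g : A) x : rtrans (f * g) x = rtrans f (rtrans g x).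
Proof. by apply: dual_inj => u; rewrite !cv_rtrans mulrA. Qed.
Lemma rtrans1 x : rtrans 1 x = x.
Proof. by apply: dual_inj => u; rewrite cv_rtrans mulr1. Qed.
Lemma rtransP a (f g : A) x : rtrans (a *: f + g) x = a *: rtrans f x + rtrans g x.
Proof.
apply: dual_inj => u; rewrite linearP /= !cv_rtrans.
by rewrite mulrDr -scalerAr cvDE cvZE.
Qed.

Lemma prod_rcons (w : seq A) f :
  \prod_(g <- rcons w f) g = (\prod_(g <- w) g) * f.
Proof. by rewrite big_rcons. Qed.

(* [aug_null n x] says that [x] is orthogonal to the [n.+1]-st power of the
   augmentation ideal of the dual algebra; this is the [n]-th term of the
   coradical filtration of a connected [H]. *)
Definition aug_null (n : nat) (x : H) : Prop :=
  forall w : seq A, size w = n.+1 -> (forall f, f \in w -> f 1 = 0) ->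
  (\prod_(f <- w) f) x = 0.

Lemma aug_nullP n x : aug_null n.+1 x <->
  forall f : A, f 1 = 0 -> aug_null n (rtrans f x).
Proof.
split=> [hx f f1 w ws w1|hx w].
  rewrite cv_rtrans -prod_rcons.
  apply: hx; first by rewrite size_rcons ws.
  by move=> g; rewrite mem_rcons inE => /orP[/eqP ->|/w1].
case/lastP: w => // w f; rewrite size_rcons => -[ws] w1.
rewrite prod_rcons -cv_rtrans; apply: hx => //.
  by apply: w1; rewrite mem_rcons inE eqxx.
by move=> g gw; apply: w1; rewrite mem_rcons inE gw orbT.
Qed.

(** Any [f] minus [f 1] times the counit lies in the augmentation ideal, so [x] is seen only through
    [eps x]. *)
Lemma aug_null0 x : aug_null 0 x <-> x = (eps x)%:A.
Proof.
split=> [hx|-> [//|f [|//]] _ f1]; last first.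
  by rewrite big_seq1 linearZ /= f1 ?inE ?eqxx // scaler0.
apply: dual_inj => f; pose g : A := f - (f 1 : k) *: (1 : A).
have : g x = 0.
  have := hx [:: g] erefl; rewrite big_seq1; apply=> u; rewrite inE => /eqP ->.
  by rewrite cvDE cvNE cvZE cv1k (eps1 h) /= [_ *: _]mulr1 subrr.
rewrite cvDE cvNE cvZE cv1k => /eqP; rewrite subr_eq0 => /eqP ->.
by rewrite linearZ; exact: mulrC.
Qed.

Lemma aug_null_sub n : is_subspace (aug_null n).
Proof.
split=> [w _ _|a x y hx hy w ws w1]; first by rewrite linear0.
by rewrite linearP /= hx // hy // scaler0 addr0.
Qed.

Lemma aug_nullS n x : aug_null n x -> aug_null n.+1 x.
Proof.
move=> hx [|f [|g w]] //= [ws] w1.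
have := hx (f * g :: w); rewrite !big_cons mulrA; apply; first by rewrite /= ws.
move=> u; rewrite inE => /orP[/eqP ->|uw].
  by rewrite cvM_1 (w1 f) ?inE ?eqxx // mul0r.
by apply: w1; rewrite !inE uw !orbT.
Qed.

Lemma aug_null_leq m n x : (m <= n)%N -> aug_null m x -> aug_null n x.
Proof. by move=> /subnK <-; elim: (n - m)%N => // d IH /IH; exact: aug_nullS. Qed.

Lemma aug_null_rtrans n f x : aug_null n x -> aug_null n (rtrans f x).
Proof.
move=> hx w; case/lastP: w => // w g; rewrite size_rcons => -[ws] w1.
rewrite cv_rtrans prod_rcons -mulrA -prod_rcons; apply: hx.
  by rewrite size_rcons ws.
move=> u; rewrite mem_rcons inE => /orP[/eqP ->|uw].
  by rewrite cvM_1 (w1 g) ?mem_rcons ?inE ?eqxx // mul0r.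
by apply: w1; rewrite mem_rcons inE uw orbT.
Qed.

(** Peel the last letter [f] of a word: it kills a second leg lying in the coradical, and the other
    pairs have a first leg covered by induction. *)
Lemma corad_filt_aug_null n x : connected D -> corad_filt D n x -> aug_null n x.
Proof.
move=> conn; elim: n x => [|n IH] x /=.
  by move/conn => [c ->]; apply/aug_null0; rewrite epsA.
move=> /in_tensor_conv[s [sR sE]].
apply/aug_nullP => f f1.
rewrite /rtrans sE; last exact: bilin_scaler.
apply: subspace_sum; first exact: aug_null_sub.
move=> p ps _; have [/conn[c cE]|/IH] := sR p ps; last exact: subspaceZ (aug_null_sub n).
rewrite cE linearZ /= f1 scaler0 scale0r; by case: (aug_null_sub n).
Qed.

End DualAlgebra.

(** * Local nilpotency of the augmentation ideal *)

Section Exhaustive.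
Variables (k : closedFieldType) (H : comAlgType k).
Variables (D : H -> seq (H * H)) (eps : H -> k) (S : H -> H).
Variables (h : is_hopf D eps S) (conn : connected D).
Local Notation A := (cvmap k^o h).

Let null x := exists n, aug_null h n x.

Lemma null_sub : is_subspace null.
Proof.
split=> [|a x y [m hx] [n hy]]; first by exists 0%N; case: (aug_null_sub h 0).
exists (maxn m n); have [_] := aug_null_sub h (maxn m n); apply.
  exact: aug_null_leq (leq_maxl _ _) hx.
exact: aug_null_leq (leq_maxr _ _) hy.
Qed.

Lemma null_rtrans (f : A) x : null x -> null (rtrans f x).
Proof. by move=> [n hx]; exists n; apply: aug_null_rtrans. Qed.

(* The translates of [x] span a finite-dimensional space, so one power of the
   augmentation ideal kills all of them. *)
Lemma null_of_rtrans x : (forall f : A, f 1 = 0 -> null (rtrans f x)) -> null x.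
Proof.
move=> hx.
have [m [z [phi [_ zE]]]] := finite_coordinates (1 :: [seq p.2 | p <- D x]).
pose psi i : A := dual_lin h (phi i).
pose psi' i : A := psi i - (psi i 1 : k) *: (1 : A).
have psi'1 i : psi' i 1 = 0.
  by rewrite cvDE cvNE cvZE cv1k (eps1 h) /= [_ *: _]mulr1 subrr.
have [n nP] : exists n, forall i : 'I_m, aug_null h n (rtrans (psi' i) x).
  have /choice[N NP] : forall i : 'I_m, exists n, aug_null h n (rtrans (psi' i) x).
    by move=> i; apply: hx.
  exists (\max_i N i) => i; exact: aug_null_leq (leq_bigmax i) (NP i).
exists n.+1; apply/aug_nullP => f f1.
have rE : rtrans f x = \sum_(i < m) (f (z i) : k) *: rtrans (psi i) x.
  rewrite /rtrans /dsum.
  under [RHS]eq_bigr => i _ do rewrite scaler_sumr.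
  rewrite exchange_big /= big_seq [RHS]big_seq; apply: eq_bigr => p pD.
  rewrite {1}(zE p.2) ?inE ?map_f ?orbT // linear_sum scaler_suml /=.
  by apply: eq_bigr => i _; rewrite linearZ /= scalerA mulrC.
have f1E : \sum_(i < m) (f (z i) : k) * psi i 1 = 0.
  transitivity (f 1); last exact: f1.
  rewrite [in RHS](zE 1) ?inE ?eqxx // linear_sum.
  by apply: eq_bigr => i _; rewrite linearZ /= mulrC.
have -> : rtrans f x = \sum_(i < m) (f (z i) : k) *: rtrans (psi' i) x.
  rewrite rE; apply/eqP; rewrite -subr_eq0 -sumrB; apply/eqP.
  transitivity ((\sum_(i < m) (f (z i) : k) * psi i 1) *: x); last by rewrite f1E scale0r.
  rewrite scaler_suml; apply: eq_bigr => i _; rewrite -scalerBr -scalerA; congr (_ *: _).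
  have -> : rtrans (psi' i) x = rtrans (psi i) x - (psi i 1 : k) *: x.
    by rewrite /psi' addrC -scaleNr rtransP rtrans1 scaleNr addrC.
  by rewrite opprB addrC subrK.
apply: subspace_sum; first exact: aug_null_sub.
by move=> i _ _; exact: subspaceZ (aug_null_sub h n) (nP i).
Qed.

Definition comb n (v : 'I_n -> H) (a : 'rV[k]_n) : H := \sum_i a 0 i *: v i.

Lemma comb_lin n (v : 'I_n -> H) : linear (comb v).
Proof.
move=> c a b; rewrite /comb scaler_sumr -big_split; apply: eq_bigr => i _ /=.
by rewrite !mxE scalerDl scalerA.
Qed.
HB.instance Definition _ n v :=
  GRing.isLinear.Build k 'rV[k]_n H *:%R (@comb n v) (comb_lin v).

Lemma comb_delta n (v : 'I_n -> H) i : comb v (delta_mx 0 i) = v i.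
Proof.
rewrite /comb (bigD1 i) //= mxE !eqxx scale1r big1 ?addr0 // => j ji.
by rewrite mxE (negPf ji) andbF scale0r.
Qed.

(** Stands for a nonzero finite-dimensional submodule of the quotient of [H] by [null], given by [n]
    spanning vectors so that no quotient space has to be built. *)
Definition stable_mod (n : nat) (v : 'I_n -> H) : Prop :=
  (forall (f : A) i, exists a, null (rtrans f (v i) - comb v a)) /\
  (exists a, ~ null (comb v a)).

(** Local finiteness of comodules: [rtrans f x] depends on [f] only through its values at finitely
    many points [z i]. *)
Lemma stable_mod_exists x : ~ null x -> exists n (v : 'I_n -> H), stable_mod v.
Proof.
move=> nx.
have [m [z [phi [_ zE]]]] := finite_coordinates [seq p.2 | p <- D x].
pose psi i : A := dual_lin h (phi i).
exists m, (fun i => rtrans (psi i) x).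
have rE (f : A) : rtrans f x = comb (fun i : 'I_m => rtrans (psi i) x) (\row_i f (z i)).
  rewrite /comb /rtrans /dsum.
  under [RHS]eq_bigr => i _ do rewrite scaler_sumr.
  rewrite exchange_big /= big_seq [RHS]big_seq; apply: eq_bigr => p pD.
  rewrite {1}(zE p.2) ?map_f // linear_sum scaler_suml /=.
  by apply: eq_bigr => i _; rewrite linearZ /= scalerA mulrC mxE.
split=> [f i|].
  exists (\row_j (f * psi i) (z j)); rewrite -rE rtransM subrr.
  by case: null_sub.
by exists (\row_i (1 : A) (z i)); rewrite -rE rtrans1.
Qed.

Section Minimal.
Variables (n : nat) (v : 'I_n -> H).
Hypotheses (vst : stable_mod v).
Hypothesis vmin : forall m (u : 'I_m -> H), stable_mod u -> (n <= m)%N.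

(** A nontrivial relation modulo [null] would let one vector of the family be dropped, against
    minimality. *)
Lemma minimal_stable_free a : null (comb v a) -> a = 0.
Proof.
move=> na; apply/eqP; apply: contrapT => /negP a0.
have [j aj] : exists j, a 0 j != 0.
  apply: contrapT => no; move: a0 => /eqP; apply; apply/rowP => j.
  by rewrite mxE; apply/eqP; apply: contrapT => /negP aj; apply: no; exists j.
pose u i := v (lift j i).
have red b : exists c, null (comb v b - comb u c).
  pose d := b - (b 0 j / a 0 j) *: a.
  exists (\row_i d 0 (lift j i)).
  have -> : comb u (\row_i d 0 (lift j i)) = comb v d.
    rewrite /comb [RHS](bigD1_ord j) //= !mxE mulfVK // subrr scale0r add0r.
    by apply: eq_bigr => i _; rewrite mxE.
  rewrite -linearB opprB addrC subrK linearZ /=.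
  exact: subspaceZ null_sub na.
have trans x b : null (x - comb v b) -> exists c, null (x - comb u c).
  move=> hx; have [c hc] := red b; exists c.
  by have := subspaceD null_sub hx hc; rewrite addrA subrK.
have : stable_mod u.
  split=> [f i|]; first by have [b hb] := vst.1 f (lift j i); exact: trans hb.
  have [b nb] := vst.2; have [c hc] := red b; exists c => nc; apply: nb.
  by rewrite -(subrK (comb u c) (comb v b)); exact: subspaceD null_sub hc nc.
move/vmin; rewrite leqNgt ltn_predL => /negP; apply.
exact: leq_ltn_trans (leq0n _) (ltn_ord j).
Qed.

(** Each [v i] is separated from the span of [null] and the other vectors, which is possible by
    freeness modulo [null]. *)
Lemma dual_basis_exists : exists phi : 'I_n -> A,
  (forall i x, null x -> phi i x = 0) /\ (forall i a, phi i (comb v a) = a 0 i).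
Proof.
have /choice[phi phiP] : forall i, exists f : A,
    (forall x, null x -> f x = 0) /\ (forall a, f (comb v a) = a 0 i).
  move=> i; pose W y := exists2 a : 'rV_n, a 0 i = 0 & null (y - comb v a).
  have sW : is_subspace W.
    split; first by exists 0; rewrite ?mxE // linear0 subr0; case: null_sub.
    move=> c y1 y2 [a ai ha] [b bi hb]; exists (c *: a + b).
      by rewrite !mxE ai bi mulr0 addr0.
    rewrite linearP opprD addrACA -scalerBr; have [_] := null_sub; exact.
  have nW : ~ W (v i).
    move=> [a ai]; rewrite -comb_delta -linearB => /minimal_stable_free/rowP /(_ i).
    by rewrite !mxE !eqxx ai subr0 => /eqP; rewrite oner_eq0.
  have [f [fW fi]] := dual_separation h sW nW; exists f; split.
    by move=> x nx; apply: fW; exists 0; rewrite ?mxE // linear0 subr0.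
  move=> a; rewrite /comb linear_sum (bigD1 i) //= linearZ /= fi big1 ?addr0.
    exact: mulr1.
  move=> j ji; rewrite linearZ /= fW ?scaler0 //.
  exists (delta_mx 0 j); first by rewrite mxE eq_sym (negPf ji) andbF.
  by rewrite comb_delta subrr; case: null_sub.
by exists phi; split=> i; case: (phiP i).
Qed.

Lemma minimal_stable_null i : null (v i).
Proof.
have [phi [phi0 phiE]] := dual_basis_exists.
pose M (f : A) : 'M[k]_n := \matrix_(j, i) phi i (rtrans f (v j)).
have MP (f : A) a : null (rtrans f (comb v a) - comb v (a *m M f)).
  have -> : rtrans f (comb v a) - comb v (a *m M f) =
      \sum_j a 0 j *: (rtrans f (v j) - comb v (row j (M f))).
    rewrite /comb linear_sum /=; under [RHS]eq_bigr => j _ do rewrite scalerBr.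
    rewrite sumrB; congr (_ - _); first by apply: eq_bigr => j _; rewrite linearZ.
    under [RHS]eq_bigr => j _ do rewrite scaler_sumr.
    rewrite exchange_big; apply: eq_bigr => l _ /=; rewrite mxE scaler_suml.
    by apply: eq_bigr => j _; rewrite scalerA !mxE.
  apply: subspace_sum; first exact: null_sub.
  move=> j _ _; apply: (subspaceZ _ null_sub).
  have [b hb] := vst.1 f j; have -> // : row j (M f) = b.
  apply/rowP => l; rewrite !mxE; have /eqP := phi0 l _ hb.
  by rewrite linearB /= phiE subr_eq0 => /eqP.
have Mphi f a i' : phi i' (rtrans f (comb v a)) = (a *m M f) 0 i'.
  have /eqP := phi0 i' _ (MP f a); by rewrite linearB /= phiE subr_eq0 => /eqP.
have MM f g : M (f * g) = M g *m M f.
  apply/matrixP => j l; rewrite mxE rtransM.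
  have := MP g (delta_mx 0 j); rewrite comb_delta => hn.
  rewrite -[rtrans g (v j)](subrK (comb v (delta_mx 0 j *m M g))) linearD linearD /=.
  rewrite phi0 ?add0r ?Mphi; last exact: null_rtrans.
  by rewrite -mulmxA -rowE mxE.
have M1 : M 1 = 1%:M.
  by apply/matrixP => j l; rewrite !mxE rtrans1 -comb_delta phiE mxE eqxx /= eq_sym.
have ML c f g : M (c *: f + g) = c *: M f + M g.
  by apply/matrixP => j l; rewrite !mxE rtransP linearP.
have M0 : M 0 = 0 by have := ML (-1) 0 0; rewrite scaleN1r addNr scaleN1r addNr.
have full : forall X, exists f, X = M f.
  apply: (@burnside k n (fun X => exists f, X = M f)).
  - split; first by exists 0.
    by move=> c X Y [f ->] [g ->]; exists (c *: f + g).
  - by move=> X Y [f ->] [g ->]; exists (g * f).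
  - move=> v0 v00 w; apply: contrapT => no.
    (* If the orbit of [v0] were proper, a row basis of it would give a stable family with fewer
       than [n] vectors. *)
    pose Q (u : 'rV[k]_n) := exists f, u = v0 *m M f.
    have sQ : is_subspace Q.
      split; first by exists 0; rewrite M0 mulmx0.
      by move=> c X Y [f ->] [g ->]; exists (c *: f + g); rewrite ML mulmxDr scalemxAr.
    have [U UP] := row_subspaceP sQ.
    have rU : (\rank U < n)%N.
      rewrite ltn_neqAle rank_leq_row andbT; apply/negP => /eqP fU; apply: no.
      have /UP[f ->] : (w <= U)%MS by apply: submx_full; rewrite /row_full fU.
      by exists (M f) => //; exists f.
    pose B := row_base U; pose u i := comb v (row i B).
    have combu a : comb u a = comb v (a *m B).
      rewrite mulmx_sum_row linear_sum; apply: eq_bigr => l _.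
      by rewrite linearZ.
    have BQ w' : Q w' -> exists a, w' = a *m B.
      by move/UP => hw; apply/submxP; rewrite eq_row_base.
    have : stable_mod u.
      split=> [f j|]; last first.
        have [|a aE] := BQ v0; first by exists 1; rewrite M1 mulmx1.
        exists a; rewrite combu -aE => /minimal_stable_free e.
        by rewrite e eqxx in v00.
      have /UP[g gE] : (row j B <= U)%MS.
        by rewrite -(eq_row_base U); exact: row_sub.
      have [|a aE] := BQ (row j B *m M f); first by exists (f * g); rewrite gE MM mulmxA.
      by exists a; rewrite combu -aE; exact: MP.
    by move/vmin; rewrite leqNgt rU.
(* Matrix coefficients: [f (c j i')] is an entry of [M f]. As [M] reverses products, the coproduct
   of [c j i'] is the sum over [l] of [c l i'] tensor [c j l]. *)
pose c j i' := ltrans (phi i') (v j).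
have cE (f : A) j i' : f (c j i') = M f j i' by rewrite cv_ltrans mxE cv_rtrans.
pose C y := exists a : 'M[k]_n, y = \sum_j \sum_i' a j i' *: c j i'.
have Cc j i' : C (c j i').
  exists (delta_mx j i'); rewrite (bigD1 j) //= (bigD1 i') //= mxE !eqxx scale1r.
  rewrite [X in _ + X]big1 ?addr0 => [|l lj]; last first.
    by rewrite big1 // => l' _; rewrite mxE (negPf lj) scale0r.
  by rewrite big1 ?addr0 // => l lj; rewrite mxE (negPf lj) andbF scale0r.
have sC : is_subspace C.
  split.
    by exists 0; rewrite big1 // => j _; rewrite big1 // => l _; rewrite mxE scale0r.
  move=> b x y [a1 ->] [a2 ->]; exists (b *: a1 + a2).
  rewrite scaler_sumr -big_split; apply: eq_bigr => j _ /=.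
  rewrite scaler_sumr -big_split; apply: eq_bigr => l _ /=.
  by rewrite !mxE scalerDl scalerA.
have Csub : subcoalg D C.
  split=> // _ [a ->].
  exists (flatten [seq [seq (a ji.1 ji.2 *: c l ji.2, c ji.1 l) | l <- enum 'I_n]
                  | ji <- enum {: 'I_n * 'I_n}]); split; last first.
    move=> p /flattenP[s /mapP[[j l] _ ->] /mapP[l' _ ->]] /=; split=> //.
    exact: subspaceZ.
  apply: (tensor_eqP (h := h)) => f g.
  rewrite -[RHS](cvME f g) big_flatten big_map /=.
  rewrite big_enum /= pair_big /= linear_sum /=; apply: eq_bigr => -[j l] _ /=.
  rewrite linearZ /= cE MM mxE big_map big_enum scaler_sumr /=; apply: eq_bigr => l' _.
  by rewrite linearZ /= !cE -scalerAl [M g _ _ * _]mulrC.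
have Csimple : simple_subcoalg D C.
  have [f0 f0E] := full (delta_mx i i).
  split=> //.
    exists (c i i); split=> // c0; have := cE f0 i i.
    rewrite c0 linear0 -f0E mxE !eqxx /= => /eqP.
    by rewrite eq_sym oner_eq0.
  move=> C' [sC' C'sub] C'C [y [C'y y0]] x [b ->].
  have C'l (f : A) z : C' z -> C' (ltrans f z).
    move=> /C'sub/in_tensor_conv[s [sP sE]].
    rewrite /ltrans sE; last exact: bilin_scalel.
    by apply: subspace_sum => // p /sP[_ h2] _; apply: subspaceZ.
  have C'r (f : A) z : C' z -> C' (rtrans f z).
    move=> /C'sub/in_tensor_conv[s [sP sE]].
    rewrite /rtrans sE; last exact: bilin_scaler.
    by apply: subspace_sum => // p /sP[h1 _] _; apply: subspaceZ.
  have [a aE] := C'C _ C'y.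
  have [p [q apq]] : exists p q, a p q != 0.
    apply: contrapT => no; apply: y0; rewrite aE big1 // => p _; rewrite big1 // => q _.
    have [->|apq] := eqVneq (a p q) 0; first by rewrite scale0r.
    by exfalso; apply: no; exists p, q.
  apply: subspace_sum => // j _ _; apply: subspace_sum => // l _ _; apply: subspaceZ => //.
  (* Matrix units on both sides isolate the nonzero coefficient [a p q] of [y], so translates of [y]
     recover every [c j l]. *)
  have [g gE] := full (delta_mx p j); have [f fE] := full (delta_mx l q).
  suff -> : c j l = (a p q)^-1 *: rtrans g (ltrans f y).
    by apply: subspaceZ => //; apply/C'r/C'l.
  apply: (dual_inj (h := h)) => u; rewrite linearZ /= cv_rtrans cv_ltrans cE aE.
  have hE j' l' : (f * (u * g)) (c j' l') = (j' == p)%:R * (M u) j l * (l' == q)%:R.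
    rewrite cE !MM -gE -fE !mxE (bigD1 l) //= big1 ?addr0.
      rewrite !mxE eqxx andTb (bigD1 j) //= big1 ?addr0; first by rewrite !mxE eqxx andbT.
      by move=> i' i'j; rewrite mxE (negPf i'j) andbF mul0r.
    by move=> i' i'j; rewrite [delta_mx _ _ _ _]mxE (negPf i'j) mulr0.
  move: (f * (u * g)) hE => F hE.
  rewrite linear_sum (bigD1 p) //= [X in _ + X]big1 ?addr0.
    rewrite linear_sum (bigD1 q) //= big1 ?addr0.
      by rewrite linearZ /= hE !eqxx mulr1 mul1r scalerA mulVf // scale1r.
    by move=> l' l'q; rewrite linearZ /= hE (negPf l'q) mulr0 scaler0.
  move=> j' j'p; rewrite linear_sum big1 // => l' _.
  by rewrite linearZ /= hE (negPf j'p) !mul0r scaler0.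
(* By connectedness the simple subcoalgebra [C] consists of scalars, so a functional vanishing at
   [1] has zero matrix. *)
apply: null_of_rtrans => f f1.
suff Mf0 : M f = 0 by have := MP f (delta_mx 0 i); rewrite Mf0 mulmx0 linear0 subr0 comb_delta.
apply/matrixP => j l; rewrite -cE [RHS]mxE.
have /conn[b ->] : coradical D (c j l).
  exists [:: c j l]; split; first by rewrite big_seq1.
  by move=> y; rewrite inE => /eqP ->; exists C.
by rewrite linearZ /= f1 scaler0.
Qed.

End Minimal.

Theorem aug_null_exhaustive x : exists n, aug_null h n x.
Proof.
apply: contrapT => nx; have [n [v vst]] := stable_mod_exists nx.
have ex : exists n, `[< exists v : 'I_n -> H, stable_mod v >].
  by exists n; apply/asboolP; exists v.
case: (ex_minnP ex) => {n v vst nx}n /asboolP[v vst] vmin.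
have [a []] := vst.2; apply: subspace_sum; first exact: null_sub.
move=> i _ _; apply: (subspaceZ _ null_sub).
apply: minimal_stable_null => // m u ust; apply: vmin; apply/asboolP; by exists u.
Qed.

End Exhaustive.

(** * Gradings and words of derivations *)

Section Projections.
Variables (k : fieldType) (H : comAlgType k) (Hg : nat -> H -> Prop).
Hypothesis dd : direct_decomp Hg.

Lemma grade_sub i : is_subspace (Hg i).
Proof. by case: dd => /(_ i). Qed.

Lemma grade0 i : Hg i 0. Proof. by case: (grade_sub i). Qed.

Lemma graded_projections : exists pr : nat -> H -> H,
  [/\ forall i, linear (pr i), forall i x, Hg i (pr i x),
      forall x, exists N, forall n, (N <= n)%N -> x = \sum_(i < n) pr i x &
      forall i j x, Hg i x -> pr j x = if j == i then x else 0].
Proof.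
have [_ dec dir] := dd.
have /choice[N /choice[xs xsP]] := dec.
(* Padding with zeros allows decompositions of different lengths to be compared. *)
pose trunc n (ys : nat -> H) i := if (i < n)%N then ys i else 0.
have truncE n m (ys : nat -> H) : (n <= m)%N -> \sum_(i < n) ys i = \sum_(i < m) trunc n ys i.
  by move=> nm; rewrite (big_ord_widen m _ nm) big_mkcond.
have truncP n ys : (forall i, Hg i (ys i)) -> forall i, Hg i (trunc n ys i).
  by move=> ysP i; rewrite /trunc; case: ifP => // _; exact: grade0.
pose pr i x := trunc (N x) (xs x) i.
have prP i x : Hg i (pr i x) by apply: truncP; case: (xsP x).
have uniq x n (ys : nat -> H) : (forall i, Hg i (ys i)) -> x = \sum_(i < n) ys i ->
    forall i, pr i x = trunc n ys i.
  move=> ysP xE i; have [Hx xE'] := xsP x.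
  pose m := maxn (N x) n; have [im|mi] := ltnP i m; last first.
    rewrite /pr /trunc !ltnNge (leq_trans (leq_maxl _ _) mi).
    by rewrite (leq_trans (leq_maxr _ _) mi).
  apply/eqP; rewrite -subr_eq0; apply/eqP.
  apply: (dir m (fun i => pr i x - trunc n ys i)) => //.
    by move=> j; apply: subspaceB; [exact: grade_sub|exact: prP|exact: truncP].
  by rewrite sumrB -!truncE ?leq_maxl ?leq_maxr // -xE -xE' subrr.
have prE x n : (N x <= n)%N -> x = \sum_(i < n) pr i x.
  by move=> /truncE <-; case: (xsP x).
exists pr; split=> //.
- move=> i a x y; pose m := maxn (N x) (N y).
  rewrite (uniq _ (maxn m i.+1) (fun j => a *: pr j x + pr j y)).
  + by rewrite /trunc leq_max ltnSn orbT.
  + by move=> j; case: (grade_sub j) => _; apply; exact: prP.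
  + rewrite big_split -scaler_sumr -!prE //.
      by rewrite leq_max leq_max leqnn orbT.
    by rewrite leq_max leq_max leqnn.
- by move=> x; exists (N x); exact: prE.
- move=> i j x Hx; rewrite (uniq _ i.+1 (fun l => if l == i then x else 0)).
  + by rewrite /trunc; case: eqVneq => [->|_]; [rewrite ltnSn|case: ifP].
  + by move=> l; case: eqP => [->|_] //; exact: grade0.
  + rewrite big_ord_recr /= eqxx big1 ?add0r // => l _.
    by rewrite (negPf (_ : _ != _)) // neq_ltn ltn_ord.
Qed.

End Projections.

Section Words.
Variables (k : fieldType) (H : comAlgType k).
Variables (D : H -> seq (H * H)) (eps : H -> k) (S : H -> H).
Variables (h : is_hopf D eps S).
Local Notation A := (cvmap k^o h).
Local Notation E := (cvmap H h).
Implicit Types (f g d : A) (u v : E).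

Definition der (d : A) : Prop := forall x y, d (x * y) = eps x * d y + d x * eps y.

Lemma lie_eltP d : lie_elt eps d <-> der d.
Proof. by split=> [[] //|dd]; split; [exact (cvfun_lin d)|]. Qed.

Lemma der1 d : der d -> d 1 = 0.
Proof.
move=> dd; have := dd 1 1; rewrite mulr1 (eps1 h) mul1r mulr1 => e.
by apply: (addrI (d 1)); rewrite addr0 -e.
Qed.

Lemma postcomp_lin f u : linear (fun x => f (u x)).
Proof. by move=> a x y; rewrite (linearP u) (linearP f). Qed.
Definition postcomp f u : A := CVMap h _ (postcomp_lin f u).

Lemma postcompE f u x : postcomp f u x = f (u x). Proof. by []. Qed.

Lemma id_linear : linear (fun x : H => x). Proof. by []. Qed.
Definition cvid : E := CVMap h _ id_linear.
Definition cvS : E := CVMap h _ (S_lin h).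

Lemma cvidE x : cvid x = x. Proof. by []. Qed.

Lemma cvS_id : cvS * cvid = 1.
Proof. by apply: cvP => x; rewrite cvME cv1E; exact: antipodel. Qed.

Lemma postcomp_id f : postcomp f cvid = f. Proof. exact: cvP. Qed.

(* [coproduct f L] says that [f], seen in the dual bialgebra, has coproduct the
   sum of the [l.1 (x) l.2] for [l] in [L]. *)
Definition coproduct f (L : seq (A * A)) : Prop :=
  forall x y, f (x * y) = \sum_(l <- L) l.1 x * l.2 y.

Lemma coproduct_one : coproduct 1 [:: (1, 1)].
Proof. by move=> x y; rewrite big_seq1 /= !cv1k (epsM h). Qed.

Lemma coproduct_der d : der d -> coproduct d [:: (1, d); (d, 1)].
Proof. by move=> dd x y; rewrite big_cons big_seq1 /= !cv1k dd. Qed.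

(** A derivation is primitive, so multiplying by it on the left multiplies the coproduct by
    [d (x) 1 + 1 (x) d]. Finite coproducts thus propagate to all words in derivations. *)
Lemma coproduct_mul d f L : der d -> coproduct f L ->
  coproduct (d * f) ([seq (d * l.1, l.2) | l <- L] ++ [seq (l.1, d * l.2) | l <- L]).
Proof.
move=> dd fL x y; rewrite [LHS](dsumM h x y (bilinM d f)) big_cat !big_map /=.
transitivity (\sum_(p <- D x) \sum_(q <- D y) \sum_(l <- L)
   ((d p.1 * l.1 p.2) * ((1 : A) q.1 * l.2 q.2) + ((1 : A) p.1 * l.1 p.2) * (d q.1 * l.2 q.2))).
  apply: eq_bigr => p _; apply: eq_bigr => q _; rewrite fL dd mulr_sumr.
  apply: eq_bigr => l _; rewrite !cv1k mulrDl addrC; congr (_ + _).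
    by rewrite mulrACA.
  by rewrite mulrACA.
under [LHS]eq_bigr => p _ do rewrite exchange_big /=.
rewrite exchange_big /= -big_split; apply: eq_bigr => l _ /=.
transitivity ((d * l.1) x * ((1 : A) * l.2) y + ((1 : A) * l.1) x * (d * l.2) y);
  last by rewrite !mul1r.
rewrite !cvME !big_distrlr /= -big_split.
apply: eq_bigr => p _; rewrite -big_split; exact: eq_bigr.
Qed.

Lemma der_sub : is_subspace der.
Proof.
split=> [x y|a f g df dg x y]; first by rewrite !cv0E mulr0 mul0r addr0.
have sc c (z : k^o) : c *: z = c * z :> k by [].
rewrite !cvDE !cvZE df dg !sc.
by move: (f x) (f y) (g x) (g y) (eps x) (eps y) => /= *; ring.
Qed.

Lemma der_bracket d e : der d -> der e -> der (d * e - e * d).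
Proof.
move=> dd de x y; rewrite !cvDE !cvNE.
rewrite (coproduct_mul dd (coproduct_der de) x y) (coproduct_mul de (coproduct_der dd) x y).
rewrite !big_cons !big_nil /= !mulr1 !cv1k.
move: ((d * e) x) ((d * e) y) ((e * d) x) ((e * d) y) (d x) (d y) (e x) (e y) => /=.
by move: (eps x) (eps y) => a b c1 c2 c3 c4 c5 c6 c7 c8; ring.
Qed.

(** The product of [E] multiplies values in [H], and the coproduct of [f] says how [f] reads such
    products. This turns identities between endomorphisms into identities between words. *)
Lemma coproduct_postcomp f L u v : coproduct f L ->
  postcomp f (u * v) = \sum_(l <- L) postcomp l.1 u * postcomp l.2 v.
Proof.
move=> fL; apply: cvP => x; rewrite postcompE cvME linear_sum cv_sumE /=.
under eq_bigr => p _ do rewrite fL.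
by rewrite exchange_big.
Qed.

Lemma postcompD f g u : postcomp (f + g) u = postcomp f u + postcomp g u.
Proof. exact: cvP. Qed.
Lemma postcompZ a f u : postcomp (a *: f) u = a *: postcomp f u.
Proof. exact: cvP. Qed.
Lemma postcompZr a f u : postcomp f (a *: u) = a *: postcomp f u.
Proof. by apply: cvP => x; rewrite postcompE !cvZE linearZ. Qed.
Lemma postcomp1 f : postcomp f 1 = (f 1 : k) *: 1.
Proof.
apply: cvP => x; rewrite postcompE cv1E cvZE cv1k linearZ.
exact: mulrC.
Qed.

End Words.

(** * Unshuffles of words and the Dynkin identity *)

Section Splits.
Variable T : Type.

(** The unshuffle coproduct: each letter goes left or right with order preserved, which is the
    coproduct of a word in primitive letters. *)
Fixpoint splits (w : seq T) : seq (seq T * seq T) :=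
  if w is d :: v then
    [seq (d :: l.1, l.2) | l <- splits v] ++ [seq (l.1, d :: l.2) | l <- splits v]
  else [:: ([::], [::])].

(** Triangularity: the left part is shorter except in one term. Inductions over words isolate that
    term. *)
Lemma splits_head w : exists r : seq (seq T * seq T), splits w = (w, [::]) :: r /\
  all (fun l => size l.1 < size w)%N r.
Proof.
elim: w => [|d v [r [e rP]]] /=; first by exists [::].
rewrite e.
exists ([seq (d :: l.1, l.2) | l <- r] ++ (v, [:: d]) :: [seq (l.1, d :: l.2) | l <- r]).
split=> //; rewrite all_cat /= ltnSn !all_map /=.
rewrite (eq_all (a2 := fun l => size l.1 < size v)%N) // rP /=.
by apply: sub_all rP => l /= /ltnW; rewrite ltnS.
Qed.

End Splits.

Section SplitsEq.
Variable T : eqType.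

Lemma splits_sub (w : seq T) l : l \in splits w -> {subset l.1 <= w} /\ {subset l.2 <= w}.
Proof.
elim: w l => [|d v IH] l /=; first by rewrite inE => /eqP ->.
rewrite mem_cat => /orP[] /mapP[l' /IH[s1 s2] ->] /=; split=> x; rewrite !inE.
- by case/orP => [->//|/s1 ->]; rewrite orbT.
- by move/s2 => ->; rewrite orbT.
- by move/s1 => ->; rewrite orbT.
- by case/orP => [->//|/s2 ->]; rewrite orbT.
Qed.

Lemma splits_weight (wt : T -> nat) (w : seq T) l : l \in splits w ->
  (\sum_(x <- l.1) wt x + \sum_(x <- l.2) wt x = \sum_(x <- w) wt x)%N.
Proof.
elim: w l => [|d v IH] l /=; first by rewrite inE => /eqP ->; rewrite !big_nil.
rewrite mem_cat => /orP[] /mapP[l' /IH e ->] /=; rewrite !big_cons -e.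
  by rewrite addnA.
by rewrite addnCA.
Qed.

End SplitsEq.

Section Dynkin.
Variable R : pzRingType.
Implicit Types w v : seq R.

Fixpoint brackets w : R :=
  match w with
  | [::] => 0
  | d :: v => if v is [::] then d else d * brackets v - brackets v * d
  end.

Lemma brackets_cons d v :
  brackets (d :: v) = d * brackets v - brackets v * d + (if v is [::] then d else 0).
Proof. by case: v => [|e v] /=; rewrite ?mulr0 ?mul0r ?subrr ?add0r // addr0. Qed.

(** When the first letter [d] goes left, the bracket contributes [d * b - b * d]; when it goes
    right, the term [b * d] cancels the subtracted one. What remains is [d] times the identity for
    the tail, plus one copy of [w] from the empty left part. *)
Lemma dynkin_identity w :
  \sum_(l <- splits w) brackets l.1 * \prod_(x <- l.2) x = (\prod_(x <- w) x) *+ size w.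
Proof.
have empty v : \sum_(l <- splits v) (if l.1 is [::] then \prod_(x <- l.2) x else 0)
    = \prod_(x <- v) x.
  elim: v => [|d v IH] /=; first by rewrite big_seq1.
  rewrite big_cat !big_map /= big1 ?add0r // big_cons -IH mulr_sumr.
  by apply: eq_bigr => -[[|? ?] l2] _ /=; rewrite ?big_cons ?mulr0.
elim: w => [|d v IH]; first by rewrite big_seq1 /= mul0r.
rewrite [splits _]/= big_cat !big_map /= -big_split big_cons /= mulrSr.
rewrite -[X in _ = _ + d * X]empty mulr_sumr -mulrnAr -IH mulr_sumr -big_split.
apply: eq_bigr => l _ /=; rewrite -/(brackets (d :: l.1)) brackets_cons big_cons.
rewrite mulrDl mulrBl !mulrA addrAC subrK; congr (_ + _).
by case: (l.1); rewrite ?mul0r ?mulr0.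
Qed.

End Dynkin.

Section GradedDual.
Variables (k : fieldType) (H : comAlgType k) (D : H -> seq (H * H)).
Variables (eps : H -> k) (S : H -> H) (h : is_hopf D eps S).
Local Notation A := (cvmap k^o h).

(** Letters are abstract with values [g d], so the same statement serves words of functionals, words
    tagged by degrees, and powers of one derivation (letters [tt]). *)
Lemma coproduct_word (T : eqType) (g : T -> A) (w : seq T) :
  (forall d, d \in w -> der (g d)) ->
  coproduct (\prod_(d <- w) g d)
    [seq (\prod_(d <- l.1) g d, \prod_(d <- l.2) g d) | l <- splits w].
Proof.
elim: w => [|d v IH] wP /=; first by rewrite !big_nil; exact: coproduct_one.
rewrite big_cons; have dd : der (g d) by apply: wP; rewrite inE eqxx.
have := coproduct_mul dd (IH (fun e ev => wP e (mem_behead (s := d :: v) ev))).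
rewrite map_cat -!map_comp.
congr (coproduct _ (_ ++ _)); by apply: eq_map => l /=; rewrite big_cons.
Qed.

Variable Hg : nat -> H -> Prop.
Hypothesis Hg_coproduct : forall i x, Hg i x ->
  in_tensor (fun a b => exists l, (l <= i)%N /\ Hg l a /\ Hg (i - l)%N b) (D x).

Lemma graded_coproduct i x : Hg i x ->
  exists s : seq (H * H),
    (forall p, p \in s -> exists l, (l <= i)%N /\ Hg l p.1 /\ Hg (i - l)%N p.2) /\
    forall (W : lmodType k) (B : H -> H -> W), bilin B ->
      dsum D B x = \sum_(p <- s) B p.1 p.2.
Proof. by move/Hg_coproduct; exact: in_tensor_conv. Qed.

Definition homogeneous (i : nat) (f : A) : Prop :=
  forall j x, j <> i -> Hg j x -> f x = 0.

Lemma homogeneousM i j f g :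
  homogeneous i f -> homogeneous j g -> homogeneous (i + j) (f * g).
Proof.
move=> fi gj l x lij /graded_coproduct[s [sP sE]].
rewrite cvME -[LHS]/(dsum D (fun a b => f a * g b) x) sE; last exact: bilinM.
rewrite big_seq big1 // => p /sP[m [ml [H1 H2]]].
have [mi|/eqP mi] := eqVneq m i; last by rewrite (fi _ _ mi H1) mul0r.
rewrite (gj _ _ _ H2) ?mulr0 // => e; apply: lij.
by rewrite -mi -e subnKC.
Qed.

End GradedDual.

(** * From a coradical grading to a Carnot grading *)

(** Right translates of [x] by functionals vanishing at [1] are scalars, which forces the coproduct
    of [x] to be [x (x) 1 + 1 (x) (x - eps x)]. *)
Lemma aug_null1_corad_filt (k : fieldType) (H : comAlgType k) (D : H -> seq (H * H))
    (eps : H -> k) (S : H -> H) (h : is_hopf D eps S) x :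
  connected D -> aug_null h 1 x -> corad_filt D 1 x.
Proof.
move=> conn /aug_nullP hx.
have c1 : coradical D 1 by apply/conn; exists 1; rewrite scale1r.
exists [:: (x, 1); (1, x - (eps x)%:A)]; split; last first.
  by move=> p; rewrite !inE => /orP[] /eqP -> /=; [left|right].
apply: (tensor_eqP (h := h)) => f g; rewrite -[RHS](cvME f g) big_cons big_seq1 /=.
pose g' : cvmap k^o h := g - (g 1 : k) *: (1 : cvmap k^o h).
have /hx/aug_null0 e : g' 1 = 0.
  by rewrite cvDE cvNE cvZE cv1k (eps1 h) /= [_ *: _]mulr1 subrr.
have := congr1 f e; rewrite linearZ /= !cv_rtrans.
have -> : f * g' = f * g - (g 1 : k) *: f.
  by rewrite /g' mulrBr -scalerAr mulr1.
rewrite cvDE cvNE cvZE.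
have -> : eps (rtrans g' x) = g' x by rewrite -(cv1k h) cv_rtrans mul1r.
rewrite /g' cvDE cvNE cvZE cv1k => /eqP; rewrite subr_eq => /eqP ->.
rewrite linearB /= linearZ /= addrC; congr (_ + _).
  by rewrite mulrC; congr (_ * _); congr (_ - _); apply: mulrC.
exact: mulrC.
Qed.

Section GradedToCarnot.
Variables (k : fieldType) (H : comAlgType k).
Variables (D : H -> seq (H * H)) (eps : H -> k) (S : H -> H).
Variables (h : is_hopf D eps S).
Hypotheses (char0 : [pchar k] =i pred0) (aff : affine_alg H) (conn : connected D).
Variable Hg : nat -> H -> Prop.
Hypothesis gr : graded_hopf D S Hg.
Hypothesis grc : forall (i : nat) (x : H), corad_filt D i x <->
  exists xs : nat -> H, (forall j, Hg j (xs j)) /\ x = \sum_(j < i.+1) xs j.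
Variable pr : nat -> H -> H.
Hypothesis pr_lin : forall i, linear (pr i).
Hypothesis prP : forall i x, Hg i (pr i x).
Hypothesis pr_sum : forall x, exists N, forall n, (N <= n)%N -> x = \sum_(i < n) pr i x.
Hypothesis prE : forall i j x, Hg i x -> pr j x = if j == i then x else 0.

Local Notation A := (cvmap k^o h).
Local Notation E := (cvmap H h).

HB.instance Definition _ i := GRing.isLinear.Build k H H *:%R (pr i) (pr_lin i).

Let dd : direct_decomp Hg. Proof. by case: gr. Qed.

Lemma graded_mul i j x y : Hg i x -> Hg j y -> Hg (i + j)%N (x * y).
Proof. by case: gr => _ e _ _; apply: e. Qed.

Let gc i x : Hg i x ->
  in_tensor (fun a b => exists l, (l <= i)%N /\ Hg l a /\ Hg (i - l)%N b) (D x).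
Proof. by case: gr => _ _ _; apply. Qed.

Local Notation homog := (homogeneous (h := h) Hg).

Lemma grade0P x : Hg 0 x <-> exists c : k, x = c%:A.
Proof.
rewrite -conn -[coradical D x]/(corad_filt D 0 x) (grc 0 x).
split=> [Hx|[xs [xsP ->]]]; last by rewrite big_ord1.
exists (fun i => if i == 0%N then x else 0); split; last by rewrite big_ord1.
by move=> j; case: eqP => [->|_] //; exact: grade0.
Qed.

Lemma grade0_eps x : Hg 0 x -> x = (eps x)%:A.
Proof. by move/grade0P => [c ->]; rewrite (epsA h). Qed.

Lemma graded_ind (W : lmodType k) (f g : {linear H -> W}) :
  (forall i x, Hg i x -> f x = g x) -> f =1 g.
Proof.
move=> e x; have [N /(_ N (leqnn N)) ->] := pr_sum x.
by rewrite !linear_sum; apply: eq_bigr => i _; exact: e (prP i x).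
Qed.

Lemma graded_ind2 (W : lmodType k) (B C : H -> H -> W) : bilin B -> bilin C ->
  (forall i j x y, Hg i x -> Hg j y -> B x y = C x y) -> forall x y, B x y = C x y.
Proof.
move=> [B1 B2] [C1 C2] e x y.
apply: (graded_ind (f := lin_of (B1 y)) (g := lin_of (C1 y))) => i {}x Hx.
by apply: (graded_ind (f := lin_of (B2 x)) (g := lin_of (C2 x))) => j {}y Hy; exact: e Hx Hy.
Qed.

Lemma homog_pr i f x : homog i f -> f (pr i x) = f x.
Proof.
move=> fi; pose g := lin_of (W := k^o) (f := fun x => f (pr i x))
  (fun a x y => etrans (congr1 f (pr_lin i a x y)) (linearP f a _ _)).
apply: (graded_ind (f := g) (g := f)) => j {}x Hx /=; rewrite (prE i Hx).
by case: eqP => // ji; rewrite (fi j x) ?linear0 // => e; apply: ji.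
Qed.

(** Homogeneity of the counit is not part of the definition of the grading. Its degree-zero
    truncation [f] is a left unit for convolution, because the coproduct is graded, and so equals
    the unit. *)
Lemma eps_homog : homog 0 1.
Proof.
have lin_e : linear (fun x => eps (pr 0 x) : k^o).
  by move=> a x y; rewrite linearP (eps_lin h).
pose f : A := CVMap h _ lin_e.
have fg (g : A) : f * g = g.
  apply: cvP => x; apply: (graded_ind (f := f * g) (g := g)) => i {}x Hx /=.
  have [s [sP sE]] := graded_coproduct gc Hx.
  rewrite -[LHS]/(dsum D (fun a b => f a * g b) x) sE; last exact: bilinM.
  have xE : x = \sum_(p <- s) (1 : A) p.1 *: p.2.
    rewrite -(sE _ (fun a b => (1 : A) a *: b)); last exact: bilin_scalel.
    by apply: (dual_inj (h := h)) => u; rewrite cv_ltrans mul1r.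
  have -> : g x = g (pr i x) by rewrite (prE i Hx) eqxx.
  rewrite [in RHS]xE !linear_sum /= big_seq [RHS]big_seq; apply: eq_bigr => p /sP[l [li [H1 H2]]].
  rewrite linearZ /= linearZ /= (prE i H2) CVMapE (prE 0 H1) cv1k [0%N == l]eq_sym.
  have -> : (i == (i - l))%N = (l == 0)%N.
    apply/eqP/eqP => [e|->]; last by rewrite subn0.
    by apply/eqP; rewrite -(eqn_add2l (i - l)) subnK // addn0 -e.
  by case: eqP => // _; rewrite -(cv1k h) !linear0 mul0r.
have -> : 1 = f by rewrite -(fg 1) mulr1.
move=> j x j0 Hx; rewrite CVMapE (prE 0 Hx) eq_sym (introF eqP j0).
by rewrite -(cv1k h) linear0.
Qed.

Lemma eps_grade i x : i <> 0%N -> Hg i x -> eps x = 0.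
Proof. by move=> i0 Hx; rewrite -(cv1k h); exact: eps_homog i0 Hx. Qed.

Lemma bilin_lin_mul (W : lmodType k) (f : {linear H -> W}) : bilin (fun x y => f (x * y)).
Proof.
split=> z a x y; first by rewrite mulrDl -scalerAl linearP.
by rewrite mulrDr -scalerAr linearP.
Qed.

Lemma bilin_eps_der (W : lmodType k) (f : {linear H -> W}) :
  bilin (fun x y => eps x *: f y + eps y *: f x).
Proof.
split=> z a x y; rewrite linearP (eps_lin h) scalerDl !scalerDr !scalerA.
  by rewrite [eps z * a]mulrC addrACA.
by rewrite [eps z * a]mulrC addrACA.
Qed.

(** Makes the degree components of a derivation derivations again. On homogeneous arguments, [eps]
    vanishes in positive degree, so only cases with a factor of degree zero contribute. *)
Lemma pr_der (d : A) i x y : der d ->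
  d (pr i (x * y)) = eps x * d (pr i y) + eps y * d (pr i x).
Proof.
move=> derd; pose f := lin_of (W := k^o) (f := fun x => d (pr i x))
  (fun a x y => etrans (congr1 d (pr_lin i a x y)) (linearP d a _ _)).
apply: (graded_ind2 (bilin_lin_mul f) (bilin_eps_der f)) => a b {}x {}y Hx Hy /=.
rewrite (prE i (graded_mul Hx Hy)) (prE i Hx) (prE i Hy).
have [a0|/eqP a0] := eqVneq a 0%N.
  rewrite a0 add0n; have [b0|/eqP b0] := eqVneq b 0%N.
    rewrite b0; case: eqP => _; last by rewrite linear0 !scaler0 addr0.
    by rewrite derd; congr (_ + _); apply: mulrC.
  rewrite (eps_grade b0 Hy) scale0r addr0; case: eqP => _; last by rewrite linear0 scaler0.
  by rewrite derd (eps_grade b0 Hy) mulr0 addr0.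
rewrite (eps_grade a0 Hx) scale0r add0r; have [b0|/eqP b0] := eqVneq b 0%N.
  rewrite b0 addn0; case: eqP => _; last by rewrite linear0 scaler0.
  by rewrite derd (eps_grade a0 Hx) mul0r add0r mulrC.
rewrite (eps_grade b0 Hy) scale0r; case: eqP => _; last by rewrite linear0.
by rewrite derd (eps_grade a0 Hx) (eps_grade b0 Hy) mul0r mulr0 addr0.
Qed.

(** Degree one contains no product of two elements of positive degree, and degree zero is the
    scalars. Hence [pr 1] is determined by the algebra generators and has finite-dimensional
    image. *)
Lemma pr1_mul x y : pr 1 (x * y) = eps x *: pr 1 y + eps y *: pr 1 x.
Proof.
apply: (graded_ind2 (bilin_lin_mul (pr 1)) (bilin_eps_der (pr 1))) => a b {}x {}y Hx Hy /=.
rewrite (prE 1 (graded_mul Hx Hy)) (prE 1 Hx) (prE 1 Hy).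
have [a0|/eqP a0] := eqVneq a 0%N.
  move: Hx; rewrite a0 add0n => /grade0_eps ->; rewrite (epsA h) scaler0 addr0.
  by case: eqP; rewrite ?scaler0 // mulr_algl.
rewrite (eps_grade a0 Hx) scale0r add0r; have [b0|/eqP b0] := eqVneq b 0%N.
  move: Hy; rewrite b0 addn0 => /grade0_eps ->; rewrite (epsA h).
  by case: eqP; rewrite ?scaler0 // mulr_algr.
rewrite (eps_grade b0 Hy) scale0r; case: a b a0 b0 {Hx Hy} => [//|a] [//|b] _ _.
by rewrite addnS addSn.
Qed.

Lemma pr0_id x : pr 0 x = (eps x)%:A.
Proof.
rewrite [LHS](grade0_eps (prP 0 x)); congr (_ *: _).
by have := homog_pr x eps_homog; rewrite !cv1k.
Qed.

Lemma pr_1 i : i <> 0%N -> pr i 1 = 0.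
Proof.
move=> /eqP i0; have H1 : Hg 0 1 by apply/grade0P; exists 1; rewrite scale1r.
by rewrite (prE i H1) (negPf i0).
Qed.

Definition grade_lie (i : nat) (d : H -> k) : Prop :=
  lie_elt eps d /\ forall j x, j <> i -> Hg j x -> d x = 0.

Lemma degree_map : exists e : E, forall i x, Hg i x -> e x = i%:R *: x.
Proof.
have /choice[N NP] := pr_sum.
pose e x := \sum_(i < N x) i%:R *: pr i x.
have prN x i : (N x <= i)%N -> pr i x = 0.
  move=> Ni; have e1 := NP x _ Ni; have := NP x _ (leqW Ni).
  by rewrite big_ord_recr /= -e1 -{1}[x]addr0 => /addrI.
have eE x n : (N x <= n)%N -> e x = \sum_(i < n) i%:R *: pr i x.
  move=> Nn; rewrite /e (big_ord_widen n (fun i => i%:R *: pr i x) Nn) big_mkcond.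
  apply: eq_bigr => i _; case: ltnP => // /prN ->; by rewrite scaler0.
have le : linear e.
  move=> a x y; pose n := maxn (N (a *: x + y)) (maxn (N x) (N y)).
  rewrite !(eE _ n) ?leq_max ?leqnn ?orbT //.
  rewrite scaler_sumr -big_split; apply: eq_bigr => i _ /=.
  by rewrite linearP scalerDr !scalerA mulrC.
exists (CVMap h _ le) => i x Hx; rewrite CVMapE.
rewrite (eE x (maxn (N x) i.+1)) ?leq_maxl //.
have lt : (i < maxn (N x) i.+1)%N by rewrite leq_max ltnSn orbT.
rewrite (bigD1 (Ordinal lt)) //= (prE i Hx) eqxx big1 ?addr0 // => j ji.
rewrite (prE j Hx); case: eqP => [e'|_]; last by rewrite scaler0.
by case/eqP: ji; apply: val_inj.
Qed.

Section FiniteBasis.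
Variables (m : nat) (z : nat -> H) (phi : nat -> {linear H -> k^o}).
Hypothesis pr1E : forall x, pr 1 x = \sum_(s < m) phi s (pr 1 x) *: z s.

Lemma basis_lin s : linear (fun x => phi s (pr 1 x)).
Proof. by move=> a x y; rewrite linearP linearP. Qed.
Definition basis (s : nat) : A := CVMap h _ (basis_lin s).

Lemma basis_der s : der (basis s).
Proof.
move=> x y; rewrite !CVMapE pr1_mul linearD /= !linearZ /=; congr (_ + _).
exact: mulrC.
Qed.

Lemma basis_homog s : homog 1 (basis s).
Proof.
move=> j x j1 Hx; rewrite CVMapE (prE 1 Hx) eq_sym (introF eqP j1).
by rewrite linear0.
Qed.

Lemma word_homog (w : seq A) : (forall d, d \in w -> homog 1 d) ->
  homog (size w) (\prod_(d <- w) d).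
Proof.
elim: w => [|d w IH] wP; first by rewrite big_nil; exact: eps_homog.
rewrite big_cons -[size _]/(1 + size w)%N; apply: (homogeneousM gc).
  by apply: wP; rewrite inE eqxx.
by apply: IH => e ew; apply: wP; rewrite inE ew orbT.
Qed.

(** Letters are indices, so that the words of a given length form a finite type, as
    [functional_combination] requires. *)
Definition bword (w : seq 'I_m) : A := \prod_(s <- w) basis s.

Lemma bword_homog w : homog (size w) (bword w).
Proof.
have := @word_homog [seq basis (val s) | s <- w]; rewrite size_map big_map; apply.
by move=> d /mapP[s _ ->]; exact: basis_homog.
Qed.

(* An element of degree [n > 1] orthogonal to the words of length [n] in degree
   one is primitive, hence lies in [H_1 = H(0) + H(1)], so vanishes. *)
Lemma bword_separate n x : Hg n x ->
  (forall w, size w = n -> bword w x = 0) -> x = 0.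
Proof.
elim/ltn_ind: n x => n IH x Hx wx.
have [n0|n0] := posnP n.
  have := wx [::] (esym n0); rewrite /bword big_nil cv1k => e.
  by rewrite n0 in Hx; rewrite (grade0_eps Hx) e scale0r.
have [n1|n2] := leqP n 1.
  have {n0 n1}n1 : n = 1%N by apply/eqP; rewrite eqn_leq n1.
  rewrite {}n1 in Hx wx *; have <- : pr 1 x = x by rewrite (prE 1 Hx) eqxx.
  rewrite pr1E big1 // => s _.
  by have := wx [:: s] erefl; rewrite /bword big_seq1 CVMapE => ->; rewrite scale0r.
have [s [sP sE]] := graded_coproduct gc Hx.
have ltr0 w : (0 < size w < n)%N -> ltrans (bword w) x = 0.
  move=> /andP[w0 wn]; apply: (IH (n - size w)%N).
  - by rewrite ltn_subrL w0.
  - rewrite /ltrans sE; last exact: bilin_scalel.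
    apply: subspace_sum; first exact: grade_sub.
    move=> p /sP[l [ln [H1 H2]]] _; have [lw|/eqP lw] := eqVneq l (size w).
      by apply: subspaceZ; [exact: grade_sub|rewrite -lw].
    by rewrite (bword_homog lw H1) scale0r; exact: grade0.
  - move=> w' w's; rewrite cv_ltrans /bword -big_cat; apply: wx.
    by rewrite size_cat w's subnKC // ltnW.
have prim : aug_null h 1 x.
  apply/aug_nullP => g g1; apply/aug_null0.
  set y := rtrans g x; rewrite -pr0_id.
  have yE : y = \sum_(p <- s) g p.2 *: p.1 by apply: sE; exact: bilin_scaler.
  (* In degree at least [n] the second leg is a scalar, killed by [g]; in degrees strictly between
     [0] and [n] the induction hypothesis applies through [ltr0]. *)
  have pry l : (0 < l)%N -> pr l y = 0.
    move=> l0; have [ln|nl] := ltnP l n; last first.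
      rewrite yE linear_sum big_seq big1 //= => p /sP[l' [l'n [H1 H2]]].
      rewrite linearZ /= (prE l H1); case: eqP => [ll|_]; last by rewrite scaler0.
      have e : (n - l' = 0)%N by apply/eqP; rewrite subn_eq0 -ll.
      by rewrite e in H2; rewrite (grade0_eps H2) linearZ /= g1 scaler0 scale0r.
    apply: (IH l ln _ (prP l y)) => w wl.
    have := homog_pr y (@bword_homog w); rewrite wl => ->.
    by rewrite cv_rtrans -cv_ltrans ltr0 ?linear0 // wl l0.
  have [N /(_ N.+1 (leqW (leqnn N))) {1}->] := pr_sum y.
  by rewrite big_ord_recl /= big1 ?addr0 // => i _; exact: pry.
have /grc[xs [xsP xE]] := aug_null1_corad_filt conn prim.
have <- : pr n x = x by rewrite (prE n Hx) eqxx.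
rewrite xE !big_ord_recl big_ord0 addr0 linearD /= (prE n (xsP 0%N)) (prE n (xsP 1%N)).
by rewrite (gtn_eqF n0) (gtn_eqF n2) addr0.
Qed.

(** [d] sees only [pr i x], and the finitely many words of length [i] separate that component. *)
Lemma lie_word_combination i (d : A) : homog i d ->
  exists (r : seq (k * seq 'I_m)), (forall p, p \in r -> size p.2 = i) /\
    d = \sum_(p <- r) p.1 *: bword p.2.
Proof.
move=> di.
pose W (j : 'I_#|{: i.-tuple 'I_m}|) : {linear H -> k^o} := bword (enum_val j).
have [x Wx|c cE] := @functional_combination k H _ W d.
  rewrite /= -(homog_pr x di) (_ : pr i x = 0) ?linear0 //.
  apply: (bword_separate (prP i x)) => w /eqP wi.
  have := homog_pr x (@bword_homog w); rewrite (eqP wi) => ->.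
  have := Wx (enum_rank (Tuple wi)); rewrite /W /= enum_rankK; exact.
exists [seq (c j, val (enum_val j)) | j <- enum 'I_#|{: i.-tuple 'I_m}|]; split.
  by move=> p /mapP[j _ ->] /=; rewrite size_tuple.
apply: cvP => x; rewrite cE cv_sumE big_map big_enum /=; exact: eq_bigr.
Qed.

Lemma grade_lie_generated (P : (H -> k) -> Prop) i (d : A) : (0 < i)%N ->
  lsubsp P -> (forall a b, P a -> P b -> P (lie_br D a b)) ->
  (forall a, grade_lie 1 a -> P a) -> der d -> homog i d -> P d.
Proof.
move=> i0 [P0 Plin] Pbr P1 derd di.
have [e eE] := degree_map.
pose theta : E := e * cvS h.
have theta_id : theta * cvid h = e by rewrite -mulrA cvS_id mulr1.
have homog_e j (f : A) : homog j f -> postcomp f e = f *+ j.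
  move=> fj; apply: cvP => x; rewrite -scaler_nat.
  apply: (graded_ind (f := postcomp f e) (g := j%:R *: f)) => l {}x Hx /=.
  rewrite postcompE (eE _ _ Hx) linearZ /= cvZE.
  by have [->//|/eqP lj] := eqVneq l j; rewrite (fj _ _ lj Hx) !scaler0.
(* Reading [theta * id = e] through [w] gives a sum over splits equal to [size w] copies of [w],
   which is also what the Dynkin identity gives for brackets. By induction all terms with shorter
   left part cancel. *)
have word_theta (w : seq A) : (forall a, a \in w -> der a /\ homog 1 a) ->
    postcomp (\prod_(a <- w) a) theta = brackets w.
  move: {2}(size w) (leqnn (size w)) => n; elim: n w => [|n IH] w.
    rewrite leqn0 size_eq0 => /eqP -> _; rewrite big_nil /=.
    have := coproduct_postcomp theta (cvid h) (coproduct_one h).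
    rewrite big_seq1 /= theta_id (homog_e 0%N); last exact: eps_homog.
    by rewrite postcomp_id mulr1.
  move=> wn wP.
  have cop := coproduct_word (g := id) (fun a aw => (wP a aw).1).
  have := coproduct_postcomp theta (cvid h) cop; rewrite theta_id.
  rewrite (homog_e (size w)); last by apply: word_homog => a /wP[].
  rewrite -dynkin_identity big_map; have [r [rE rP]] := splits_head w.
  rewrite rE !big_cons /= big_nil mulr1 postcomp_id mulr1.
  suff -> : \sum_(l <- r) brackets l.1 * \prod_(x <- l.2) x =
      \sum_(l <- r) postcomp (\prod_(a <- l.1) a) theta * postcomp (\prod_(a <- l.2) a) (cvid h).
    by move=> /addIr ->.
  rewrite big_seq [RHS]big_seq; apply: eq_bigr => l lr.
  rewrite postcomp_id IH //; first by have := allP rP l lr => /= lt; rewrite -ltnS (leq_trans lt).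
  have [s1 _] : {subset l.1 <= w} /\ {subset l.2 <= w}.
    by apply: splits_sub; rewrite rE inE lr orbT.
  by move=> a /s1/wP.
(* As [d] is primitive, only two terms occur, and the one with [theta] under the counit is the
   bracket of the empty word, zero. *)
have dtheta : postcomp d theta = d *+ i.
  have := coproduct_postcomp theta (cvid h) (coproduct_der derd).
  rewrite theta_id (homog_e i) // big_cons big_seq1 /= !postcomp_id mulr1 => ->.
  by have := word_theta [::]; rewrite big_nil /= => -> //; rewrite mul0r add0r.
have PA : is_subspace (fun f : A => P f).
  split; first exact: P0.
  by move=> a f g Pf Pg; exact: (Plin a f g Pf Pg).
have Pbrk (w : seq A) : (forall a, a \in w -> der a /\ homog 1 a) -> P (brackets w).
  elim: w => [|a w IH] wP; first exact: P0.
  have Pa : P a.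
    apply: P1; have [a1 a2] := wP a (mem_head _ _); split; first exact/lie_eltP.
    exact: a2.
  case: w IH wP => [|b w] IH wP //.
  have Pw : P (brackets (b :: w)) by apply: IH => c cw; apply: wP; rewrite inE cw orbT.
  exact: (Pbr _ _ Pa Pw).
have : P (d *+ i).
  rewrite -dtheta; have [r [rs ->]] := lie_word_combination di.
  have -> : postcomp (\sum_(p <- r) p.1 *: bword p.2) theta =
      \sum_(p <- r) p.1 *: postcomp (bword p.2) theta.
    apply: cvP => x; rewrite postcompE !cv_sumE; exact: eq_bigr.
  apply: (subspace_sum (P := fun f : A => P f)) => // p pr' _.
  apply: (subspaceZ (P := fun f : A => P f)) => //.
  rewrite /bword -(big_map (fun s : 'I_m => basis s) xpredT id).
  have bP a : a \in [seq basis (val s) | s <- p.2] -> der a /\ homog 1 a.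
    by move=> /mapP[s _ ->]; split; [exact: basis_der|exact: basis_homog].
  rewrite word_theta //; exact: Pbrk.
move=> Pd; have := subspaceZ (i%:R^-1 : k) PA Pd.
by rewrite -scaler_nat scalerA mulVf ?scale1r // natr_neq0.
Qed.

End FiniteBasis.

Theorem graded_carnot : carnot D eps.
Proof.
have [gens gensP] := aff.
have [m [z [phi [_ zE]]]] := finite_coordinates [seq pr 1 x | x <- gens].
have pr1E x : pr 1 x = \sum_(s < m) phi s (pr 1 x) *: z s.
  pose Q x := x = \sum_(s < m) phi s x *: z s.
  have sQ : is_subspace Q.
    split; first by rewrite /Q big1 // => s _; rewrite linear0 scale0r.
    move=> a u v Qu Qv; rewrite /Q {1}Qu {1}Qv scaler_sumr -big_split.
    by apply: eq_bigr => s _; rewrite linearP scalerDl scalerA.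
  apply: (gensP (fun x => Q (pr 1 x))).
  - split; first by rewrite linear0; case: sQ.
    by move=> a u v Qu Qv; rewrite linearP; case: sQ => _; apply.
  - by rewrite pr_1 //; case: sQ.
  - by move=> u v Qu Qv; rewrite pr1_mul; apply: subspaceD => //; apply: subspaceZ.
  - by move=> u ug; apply: zE; apply: map_f.
have /choice[N NP] := pr_sum.
(* No generator has a component of degree above [t], so a homogeneous derivation of larger degree
   vanishes on generators, hence everywhere. *)
pose t := \max_(x <- gens) N x.
have top i (d : A) : der d -> homog i d -> (t < i)%N -> d = 0.
  move=> derd di ti; apply: cvP => x; rewrite cv0E; move: x; apply: gensP.
  - split; first exact: linear0.
    by move=> a u v du dv; rewrite linearP /= du dv scaler0 addr0.
  - exact: der1.
  - by move=> u v du dv; rewrite derd du dv mulr0 mul0r addr0.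
  - move=> x xg; rewrite (NP x _ (leqnn _)) linear_sum big1 //= => j _.
    apply: (di j) => // e; move: ti; rewrite -e ltnNge => /negP; apply.
    apply: leq_trans (ltnW (ltn_ord j)) _; exact: leq_bigmax_seq.
have zero (d : A) : der d -> homog 0 d -> d = 0.
  move=> derd d0; apply: cvP => x.
  by rewrite -(homog_pr x d0) pr0_id linearZ /= (der1 derd) scaler0.
have toA d : lie_elt eps d -> exists2 d' : A, (d' : H -> k) = d & der d'.
  by move=> [ld dd']; exists (dual_of h ld).
have comp_pr i (d : A) : der d -> grade_lie i (fun x => d (pr i x)).
  move=> derd; split; first split.
  - by move=> a x y; rewrite linearP; exact (cvfun_lin d a _ _).
  - by move=> x y; rewrite pr_der // [eps y * _]mulrC.
  - by move=> j x ji Hx; rewrite (prE i Hx) eq_sym (introF eqP ji) linear0.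
have decomp (d : A) : der d -> forall x, d x = \sum_(1 <= i < t.+1) d (pr i x).
  move=> derd x.
  have lin_i i : lin_fun (fun x => d (pr i x)) by case: (comp_pr i d derd) => -[].
  have vanish i : (i == 0)%N || (t < i)%N -> d (pr i x) = 0.
    have [[l1 l2] l3] := comp_pr i d derd.
    pose d' : A := dual_of h l1; rewrite -[d (pr i x)]/(d' x).
    case/orP => [/eqP e|ti]; last by rewrite (top i d' l2 l3 ti).
    by have := l3; rewrite {1}e => l3'; rewrite (zero d' l2 l3').
  have := NP x (N x + t.+1)%N (leq_addr _ _) => xE.
  rewrite {1}xE linear_sum /= -(big_mkord xpredT (fun i => d (pr i x))).
  rewrite big_ltn ?addn_gt0 ?orbT // vanish // add0r.
  rewrite (@big_cat_nat _ _ _ t.+1) ?leq_addl //= [X in _ + X]big_nat_cond.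
  rewrite [X in _ + X]big1 ?addr0 // => i /andP[/andP[ti _] _].
  by apply: vanish; rewrite ti orbT.
exists t, grade_lie; split; first split; first split.
- by split=> //; split=> [a x y|x y]; rewrite ?mulr0 ?mul0r addr0.
- move=> a d e [/toA[d' <- dd'] d3] [/toA[e' <- de'] e3]; split; last first.
    by move=> j x ji Hx; rewrite (d3 j x ji Hx) (e3 j x ji Hx) mulr0 addr0.
  apply/(lie_eltP (a *: d' + e')); case: (der_sub h) => _; exact.
- by move=> d [].
split; last split; last split; last split.
- move=> i hi d [/toA[d' <- dd'] d3] x.
  case/orP: hi => [/eqP e|ti]; last by rewrite (top i d' dd' d3 ti).
  by rewrite e in d3; rewrite (zero d' dd' d3).
- move=> d /toA[d' <- dd']; exists (fun i x => d' (pr i x)); split=> [i|x].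
    exact: comp_pr.
  exact: decomp.
- move=> ds dsP ds0 i x.
  have lin_i j : lin_fun (ds j) by case: (dsP j) => -[].
  pose d j : A := dual_of h (lin_i j).
  have di j : homog j (d j) by case: (dsP j).
  have dd' j : der (d j) by apply/lie_eltP; case: (dsP j).
  rewrite -[ds i x]/(d i x).
  have [i0|i0] := posnP i.
    by have := di i; rewrite {1}i0 => d0; rewrite (zero (d i)).
  have [ti|it] := ltnP t i; first by rewrite (top i (d i)).
  rewrite -(homog_pr x (di i)); have := ds0 (pr i x).
  rewrite (bigD1_seq i) ?iota_uniq //=; last by rewrite mem_index_iota i0 ltnS.
  rewrite big1 ?addr0 // => j ji.
  by apply: (di j i) => // e; rewrite e eqxx in ji.
- move=> i j d e [/toA[d' <- dd'] d3] [/toA[e' <- de'] e3]; split.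
    apply/(lie_eltP (d' * e' - e' * d')); exact: der_bracket.
  move=> l x lij Hx.
  have h1 : (d' * e') x = 0 by apply: (homogeneousM gc (i := i) (j := j)) lij Hx.
  have h2 : (e' * d') x = 0 by apply: (homogeneousM gc (i := j) (j := i)) Hx => //; rewrite addnC.
  exact: (etrans (congr2 (fun a b : k => a - b) h1 h2) (subrr 0)).
- move=> P sP Pbr P1 d /toA[d' <- dd'].
  have Psum (r : seq nat) : (forall i, i \in r -> 0 < i)%N ->
      P (fun x => \sum_(i <- r) d' (pr i x)).
    elim: r => [|i r IH] r0.
      by rewrite (_ : (fun x => _) = fun=> 0); [case: sP|apply: funext => x; rewrite big_nil].
    have := sP.2 1 (fun x => d' (pr i x)) (fun x => \sum_(j <- r) d' (pr j x)).
    rewrite (_ : (fun x => 1 * d' (pr i x) + \sum_(j <- r) d' (pr j x)) =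
      (fun x => \sum_(j <- i :: r) d' (pr j x))); last first.
      by apply: funext => x; rewrite mul1r big_cons.
    apply; last by apply: IH => j jr; apply: r0; rewrite inE jr orbT.
    have [[l1 l2] l3] := comp_pr i d' dd'.
    apply: (grade_lie_generated pr1E (i := i) (d := dual_of h l1)) => //.
    by apply: r0; rewrite inE eqxx.
  have -> : (d' : H -> k) = fun x => \sum_(i <- index_iota 1 t.+1) d' (pr i x).
    by apply: funext => x; exact: decomp.
  by apply: Psum => i; rewrite mem_index_iota => /andP[].
Qed.

End GradedToCarnot.

Theorem coradically_graded_carnot (k : fieldType) (H : comAlgType k)
    (D : H -> seq (H * H)) (eps : H -> k) (S : H -> H) :
  [pchar k] =i pred0 -> is_hopf D eps S -> affine_alg H -> connected D ->
  coradically_graded D S -> carnot D eps.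
Proof.
move=> char0 h aff conn [Hg [gr grc]].
have dd : direct_decomp Hg by case: gr.
have [pr [pl pP ps pE]] := graded_projections dd.
exact: (graded_carnot h char0 aff conn gr grc pl pP ps pE).
Qed.

(** * Adams operations and the Eulerian idempotent *)

Section Adams.
Variables (k : fieldType) (H : comAlgType k).
Variables (D : H -> seq (H * H)) (eps : H -> k) (S : H -> H).
Variables (h : is_hopf D eps S).
Hypotheses (char0 : [pchar k] =i pred0) (exh : forall x, exists n, aug_null h n x).
Local Notation A := (cvmap k^o h).
Local Notation E := (cvmap H h).
Local Notation idE := (cvid h).

(** [aug_null] speaks of scalar functionals; expanding the values of the last factor in finite
    coordinates turns that factor into functionals vanishing at [1] and shortens the product. *)
Lemma aug_null_prod (l : seq E) n x : size l = n.+1 ->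
  (forall a, a \in l -> a 1 = 0) -> aug_null h n x -> (\prod_(a <- l) a) x = 0.
Proof.
elim: n l x => [|n IH] l x.
  case: l => [|a [|]] // _ aP /aug_null0 ->.
  by rewrite big_seq1 linearZ /= aP ?scaler0 // inE eqxx.
case/lastP: l => // l a; rewrite size_rcons => -[ls] aP /aug_nullP hx.
rewrite big_rcons /=; set b := \prod_(c <- l) c; rewrite cvME.
have [m [z [phi [_ zE]]]] := finite_coordinates [seq a p.2 | p <- D x].
pose psi i : A := postcomp (dual_lin h (phi i)) a.
transitivity (\sum_(i < m) b (rtrans (psi i) x) * z i).
  under [RHS]eq_bigr => i _ do rewrite /rtrans /dsum linear_sum mulr_suml.
  rewrite exchange_big /= big_seq [RHS]big_seq; apply: eq_bigr => p pD.
  have e := zE (a p.2) (map_f (fun p => a p.2) pD).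
  rewrite [in LHS]e mulr_sumr; apply: eq_bigr => i _.
  by rewrite linearZ /= -scalerAr -scalerAl.
rewrite big1 // => i _; rewrite IH ?mul0r //.
  by move=> c cl; apply: aP; rewrite mem_rcons inE cl orbT.
apply: hx; rewrite postcompE (aP a) ?linear0 // mem_rcons mem_head //.
Qed.

Lemma aug_null_exp (a : E) n m x : (n < m)%N -> a 1 = 0 -> aug_null h n x -> (a ^+ m) x = 0.
Proof.
case: m => // m; rewrite ltnS => nm a1 /(aug_null_leq nm) hx.
have := @aug_null_prod (nseq m.+1 a) m x; rewrite size_nseq big_nseq -Monoid.iteropE.
rewrite (_ : iterop _ _ _ _ = a ^+ m.+1) //; apply=> // b.
by rewrite mem_nseq => /andP[_ /eqP ->].
Qed.

Lemma binomial_poly (i m : nat) :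
  (\prod_(j < i) ('X - (j%:R)%:P) : {poly H}).[m%:R] = (m ^_ i)%:R.
Proof.
rewrite horner_prod; elim: i => [|i IH]; first by rewrite big_ord0 ffactn0.
rewrite big_ord_recr /= IH hornerXsubC ffactnSr natrM.
have [im|mi] := leqP i m; first by rewrite natrB.
by rewrite ffact_small // !mul0r.
Qed.

Lemma adams_poly_exists x : exists p : {poly H}, forall m : nat, p.[m%:R] = (idE ^+ m) x.
Proof.
have [n hx] := exh x; pose z : E := idE - 1.
have z1 : z 1 = 0 by rewrite cvDE cvNE cv1E cvidE (eps1 h) scale1r subrr.
(* Binomial expansion of [(z + 1) ^+ m], with ['C(m, i)] written as a falling factorial over [i!];
   powers of [z] beyond [n] kill [x]. *)
exists (\sum_(i < n.+1) ((i`!)%:R^-1 *: (z ^+ i) x) *: \prod_(j < i) ('X - (j%:R)%:P)) => m.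
have -> : idE = z + 1 by rewrite subrK.
rewrite exprD1n horner_sum cv_sumE.
pose F i := (z ^+ i) x *+ 'C(m, i).
have FE i : (((i`!)%:R^-1 *: (z ^+ i) x) *: \prod_(j < i) ('X - (j%:R)%:P)).[m%:R] = F i.
  rewrite hornerZ binomial_poly -bin_ffact mulr_natr mulrnA mulrnAC /F.
  congr (_ *+ _); by rewrite -scaler_nat scalerA mulfV ?scale1r ?natr_neq0 ?fact_gt0.
have F0 i : (n < i)%N -> F i = 0 by move=> ni; rewrite /F (aug_null_exp ni) // mul0rn.
have F0' i : (m < i)%N -> F i = 0 by move=> ni; rewrite /F bin_small.
have wide a b : (forall i, (a < i)%N -> F i = 0) -> (a <= b)%N ->
    \sum_(i < a.+1) F i = \sum_(i < b.+1) F i.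
  move=> Fa ab; rewrite (big_ord_widen b.+1 F) ?ltnS // big_mkcond.
  by apply: eq_bigr => i _; case: ltnP => // /Fa.
transitivity (\sum_(i < n.+1) F i); first by apply: eq_bigr => i _; exact: FE.
transitivity (\sum_(i < m.+1) F i).
  rewrite (wide n (maxn n m)) ?leq_maxl // (wide m (maxn n m)) ?leq_maxr //.
by apply: eq_bigr => i _; rewrite /F -!scaler_nat cvZE.
Qed.

Definition adams_poly x : {poly H} := sval (cid (adams_poly_exists x)).

Lemma adams_polyE x m : (adams_poly x).[m%:R] = (idE ^+ m) x.
Proof. by rewrite /adams_poly; case: cid. Qed.

Lemma adams_poly_uniq x (p : {poly H}) :
  (forall m : nat, p.[m%:R] = (idE ^+ m) x) -> adams_poly x = p.
Proof. by move=> pE; apply: (poly_alg_nat_inj char0) => m; rewrite adams_polyE pE. Qed.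

Lemma adams_poly_lin a x y : adams_poly (a *: x + y) = a%:A *: adams_poly x + adams_poly y.
Proof.
by apply: adams_poly_uniq => m; rewrite hornerD hornerZ !adams_polyE linearP mulr_algl.
Qed.

(** This endomorphism is dual to the [m]-th power map of [U]; commutativity of [H] makes it
    multiplicative. *)
Lemma cvidX_mul m x y : (idE ^+ m) (x * y) = (idE ^+ m) x * (idE ^+ m) y.
Proof.
elim: m x y => [|m IH] x y; first by rewrite !cv1E (epsM h) -scalerAl mul1r scalerA.
rewrite exprS [LHS](dsumM h x y (bilinM idE (idE ^+ m))) !cvME big_distrlr /=.
apply: eq_bigr => p _; apply: eq_bigr => q _; by rewrite !cvidE IH mulrACA.
Qed.

Lemma adams_polyM x y : adams_poly (x * y) = adams_poly x * adams_poly y.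
Proof. by apply: adams_poly_uniq => m; rewrite hornerM !adams_polyE cvidX_mul. Qed.

Lemma euler_lin r : linear (fun x => (adams_poly x)`_r).
Proof. by move=> a x y; rewrite adams_poly_lin coefD coefZ mulr_algl. Qed.
Definition euler r : E := CVMap h _ (euler_lin r).

Lemma euler0 : euler 0 = 1.
Proof. by apply: cvP => x; rewrite CVMapE -horner_coef0 -(adams_polyE x 0). Qed.

(** The coefficient of ['X] in [adams_polyM], the constant coefficients being given by the
    counit. *)
Lemma eulerM x y : euler 1 (x * y) = eps x *: euler 1 y + eps y *: euler 1 x.
Proof.
rewrite CVMapE adams_polyM coefM !big_ord_recl big_ord0 addr0 /=.
rewrite -![(adams_poly _)`_0]/(euler 0 _) euler0 !cv1E mulr_algl.
by rewrite [_ * _%:A]mulr_algr.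
Qed.

Lemma euler1_1 : euler 1 1 = 0.
Proof.
have := eulerM 1 1; rewrite mulr1 (eps1 h) scale1r => e.
by apply: (addrI (euler 1 1)); rewrite addr0 -e.
Qed.

(* Differentiating Psi^(m+n) = Psi^m * Psi^n with respect to m at m = 0. *)
Lemma euler_succ b : euler 1 * euler b = euler b.+1 *+ b.+1.
Proof.
apply: cvP => x.
have step n : \sum_(p <- D x) (adams_poly p.1) * (adams_poly p.2).[n%:R]%:P =
    adams_poly x \Po ('X + n%:R%:P).
  apply: (poly_alg_nat_inj char0) => m; rewrite horner_sum horner_comp.
  rewrite hornerD hornerX hornerC -natrD adams_polyE exprD cvME.
  by apply: eq_bigr => p _; rewrite hornerM hornerC !adams_polyE.
have step2 : \sum_(p <- D x) (euler 1 p.1)%:P * adams_poly p.2 = (adams_poly x)^`().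
  apply: (poly_alg_nat_inj char0) => n; rewrite horner_sum.
  transitivity ((adams_poly x \Po ('X + n%:R%:P))^`()).[0].
    rewrite -step horner_coef0 coef_deriv mulr1n coef_sum.
    by apply: eq_bigr => p _; rewrite coefMC hornerM hornerC.
  rewrite deriv_comp derivD derivX derivC addr0 mulr1 horner_comp.
  by rewrite hornerD hornerX hornerC add0r.
rewrite cvME -scaler_nat cvZE scaler_nat.
have := congr1 (fun p : {poly H} => p`_b) step2; rewrite coef_deriv coef_sum => <-.
by apply: eq_bigr => p _; rewrite coefCM.
Qed.

Lemma euler_exp r : euler 1 ^+ r = euler r *+ r`!.
Proof.
elim: r => [|r IH]; first by rewrite euler0 expr0.
by rewrite exprS IH mulrnAr euler_succ factS mulrnA.
Qed.

Lemma euler_eq r : euler r = (r`!)%:R^-1 *: euler 1 ^+ r.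
Proof. by rewrite euler_exp -scaler_nat scalerA mulVf ?scale1r ?natr_neq0 ?fact_gt0. Qed.

Lemma euler_vanish n r x : aug_null h n x -> (n < r)%N -> euler r x = 0.
Proof.
by move=> hx nr; rewrite euler_eq cvZE (aug_null_exp nr) ?scaler0 // euler1_1.
Qed.

Lemma exp_euler n x : aug_null h n x ->
  x = \sum_(r < n.+1) (r`!)%:R^-1 *: (euler 1 ^+ r) x.
Proof.
move=> hx; have {1}-> : x = (adams_poly x).[1%:R] by rewrite adams_polyE expr1.
transitivity (\sum_(r < n.+1) euler r x); last first.
  by apply: eq_bigr => r _; rewrite euler_eq cvZE.
have sz : (size (adams_poly x) <= n.+1)%N.
  by apply/leq_sizeP => r nr; exact: (euler_vanish hx nr).
rewrite (horner_coef_wide _ sz); apply: eq_bigr => r _.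
by rewrite expr1n mulr1.
Qed.

Lemma split_weights (R : comPzRingType) (T : Type) (w : seq T) (a b : R) :
  \sum_(l <- splits w) a ^+ size l.1 * b ^+ size l.2 = (a + b) ^+ size w.
Proof.
elim: w => [|x w IH]; first by rewrite big_seq1 !expr0 mulr1.
rewrite [splits _]/= big_cat !big_map /= exprS -IH mulrDl !mulr_sumr.
congr (_ + _); apply: eq_bigr => l _; first by rewrite exprS mulrA.
by rewrite exprS mulrCA.
Qed.

Lemma prod_const (T : Type) (w : seq T) (d : A) : \prod_(x <- w) d = d ^+ size w.
Proof. by elim: w => [|x w IH]; rewrite ?big_nil ?big_cons ?IH ?exprS. Qed.

Lemma der_exp_coproduct (d : A) r : der d ->
  coproduct (d ^+ r) [seq (d ^+ size l.1, d ^+ size l.2) | l <- splits (nseq r tt)].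
Proof.
move=> dd; have := @coproduct_word k H D eps S h _ (fun=> d) (nseq r tt) (fun _ _ => dd).
rewrite prod_const size_nseq; congr (coproduct _ _); apply: eq_map => l.
by rewrite !prod_const.
Qed.

Lemma der_exp_1 (d : A) r : der d -> (d ^+ r) 1 = (0 : k) ^+ r.
Proof.
move=> dd; elim: r => [|r IH]; first by rewrite !expr0 cv1k (eps1 h).
by rewrite exprS cvM_1 (der1 dd) mul0r exprS mul0r.
Qed.

(** On the one-parameter subgroup of [d], taking [m]-th powers multiplies the parameter by [m].
    Induction on [m]: the coproduct of [d ^+ r] is binomial, and [split_weights] resums it. *)
Lemma der_exp_adams (d : A) r m : der d ->
  postcomp (d ^+ r) (idE ^+ m) = (m%:R : k) ^+ r *: d ^+ r.
Proof.
move=> dd; elim: m r => [|m IH] r.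
  rewrite expr0 postcomp1 der_exp_1 //; case: r => [|r]; first by rewrite !expr0.
  by rewrite exprS mul0r !scale0r.
rewrite exprS (coproduct_postcomp _ _ (der_exp_coproduct r dd)) big_map.
rewrite -natr1 addrC -[r in RHS](size_nseq r tt) -split_weights scaler_suml.
rewrite big_seq [RHS]big_seq; apply: eq_bigr => l lr /=.
rewrite postcomp_id IH expr1n mul1r -scalerAr -exprD.
have := splits_weight (fun=> 1%N) lr; rewrite !sum1_size size_nseq => ->.
by [].
Qed.

(** Compares coefficients of the powers of [m] in [der_exp_adams]. *)
Lemma der_exp_euler (d : A) r s : der d ->
  postcomp (d ^+ r) (euler s) = if r == s then d ^+ r else 0.
Proof.
move=> dd; apply: cvP => x; rewrite postcompE.
pose q := \poly_(i < size (adams_poly x)) ((d ^+ r) (adams_poly x)`_i : k).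
have qE : q = ((d ^+ r) x : k) *: 'X^r.
  apply/eqP; rewrite -subr_eq0; apply/eqP/(poly_nat_eq0 char0) => m.
  rewrite hornerD hornerN hornerZ hornerXn horner_poly; apply/eqP; rewrite subr_eq0; apply/eqP.
  have := congr1 (fun f : A => f x) (der_exp_adams r m dd).
  rewrite postcompE -adams_polyE horner_coef linear_sum cvZE /=.
  move=> e; rewrite mulrC -[RHS]e; apply: eq_bigr => i _.
  by rewrite -!natrX mulr_natr mulr_natr linearMn.
have := congr1 (fun p : {poly k} => p`_s) qE; rewrite coef_poly coefZ coefXn eq_sym CVMapE.
case: ltnP => [_ ->|sz]; first by case: eqP; rewrite ?mulr1 // mulr0.
rewrite nth_default // linear0; by case: eqP => _ //=; rewrite mulr1.
Qed.

Lemma der_euler (d : A) x : der d -> d (euler 1 x) = d x.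
Proof. by move=> dd; have := der_exp_euler 1 1 dd; rewrite eqxx expr1 => {2}<-. Qed.

End Adams.

(** * From a Carnot grading to a coradical grading *)

Lemma splits_size0 (V : zmodType) (T : Type) (w : seq T) (G : nat -> V) :
  \sum_(l <- splits w) (if size l.1 == 0%N then G (size l.2) else 0) = G (size w).
Proof.
elim: w G => [|x w IH] G; first by rewrite big_seq1.
by rewrite [splits _]/= big_cat !big_map /= big1 ?add0r // (IH (fun n => G n.+1)).
Qed.

Lemma splits_size1 (V : zmodType) (T : Type) (w : seq T) (G : nat -> V) :
  \sum_(l <- splits w) (if size l.1 == 1%N then G (size l.2) else 0) =
  G (size w).-1 *+ size w.
Proof.
elim: w G => [|x w IH] G; first by rewrite big_seq1.
rewrite [splits _]/= big_cat !big_map /= (IH (fun n => G n.+1)).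
under eq_bigr => l _ do rewrite eqSS.
by rewrite splits_size0 mulrS; case: (size w).
Qed.

(** * Powers of the augmentation ideal, seen as annihilators *)

Section AugNullIdeals.
Variables (k : fieldType) (H : comAlgType k).
Variables (D : H -> seq (H * H)) (eps : H -> k) (S : H -> H).
Variables (h : is_hopf D eps S).
Local Notation A := (cvmap k^o h).

(** The double annihilator of the [i]-th power of the augmentation ideal. The index shifts because
    [aug_null n] is orthogonal to the power [n.+1]; the zeroth power is the whole algebra. *)
Definition kills (i : nat) (f : A) : Prop :=
  if i is i'.+1 then forall x, aug_null h i' x -> f x = 0 else True.

Lemma kills_sub i : is_subspace (kills i).
Proof.
case: i => [|i]; first by [].
split=> [x _|a f g fi gi x hx]; first by rewrite cv0E.
by rewrite cvDE cvZE fi // gi // scaler0 addr0.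
Qed.

Lemma aug_null_ltrans n (f : A) x : aug_null h n x -> aug_null h n (ltrans f x).
Proof.
move=> hx [|g w] // [ws] w1; rewrite cv_ltrans big_cons mulrA.
have := hx (f * g :: w); rewrite big_cons; apply; first by rewrite /= ws.
move=> u; rewrite inE => /orP[/eqP ->|uw].
  by rewrite cvM_1 (w1 g) ?inE ?eqxx // mulr0.
by apply: w1; rewrite !inE uw !orbT.
Qed.

Lemma killsM i j f g : kills i f -> kills j g -> kills (i + j) (f * g).
Proof.
case: i => [|i]; case: j => [|j] // fi gj.
- by move=> x /(aug_null_ltrans f) hx; rewrite -cv_ltrans gj.
- by rewrite addn0 => x /(aug_null_rtrans g) hx; rewrite -cv_rtrans fi.
rewrite addSn addnS => x hx; rewrite -cv_rtrans fi // => w ws w1.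
rewrite cv_rtrans -cv_ltrans gj // => w' w's w'1.
rewrite cv_ltrans -big_cat; apply: hx; first by rewrite size_cat ws w's addSn addnS.
by move=> a; rewrite mem_cat => /orP[/w1|/w'1].
Qed.

End AugNullIdeals.

Section CarnotToGraded.
Variables (k : fieldType) (H : comAlgType k).
Variables (D : H -> seq (H * H)) (eps : H -> k) (S : H -> H).
Variables (h : is_hopf D eps S).
Hypotheses (char0 : [pchar k] =i pred0) (exh : forall x, exists n, aug_null h n x).
Hypotheses (aff : affine_alg H) (conn : connected D).
Local Notation A := (cvmap k^o h).
Local Notation E := (cvmap H h).

Variables (t : nat) (u : nat -> (H -> k) -> Prop).
Hypothesis u_sub : forall i, lsubsp (u i) /\ (forall d, u i d -> lie_elt eps d).
Hypothesis u_zero : forall i, (i == 0)%N || (t < i)%N -> forall d, u i d -> forall x, d x = 0.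
Hypothesis u_dec : forall d, lie_elt eps d -> exists ds : nat -> H -> k,
  (forall i, u i (ds i)) /\ forall x, d x = \sum_(1 <= i < t.+1) ds i x.
Hypothesis u_dir : forall ds : nat -> H -> k, (forall i, u i (ds i)) ->
  (forall x, \sum_(1 <= i < t.+1) ds i x = 0) -> forall i x, ds i x = 0.
Hypothesis u_br : forall i j d e, u i d -> u j e -> u (i + j)%N (lie_br D d e).
Hypothesis u_gen : forall P : (H -> k) -> Prop, lsubsp P ->
  (forall d e, P d -> P e -> P (lie_br D d e)) ->
  (forall d, u 1%N d -> P d) -> forall d, lie_elt eps d -> P d.

Definition ug (i : nat) (f : A) : Prop := u i f.

Lemma ug_sub i : is_subspace (ug i).
Proof.
have [[u0 ul] _] := u_sub i; split; first exact: u0.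
by move=> a f g uf ug; exact: (ul a f g uf ug).
Qed.

Lemma ug_der i f : ug i f -> der f.
Proof. by move=> uf; apply/lie_eltP; have [_] := u_sub i; apply. Qed.

Lemma ug_zero i f : (i == 0)%N || (t < i)%N -> ug i f -> f = 0.
Proof. by move=> ti uf; apply: cvP => x; exact: (u_zero ti uf). Qed.

Lemma ug_dec f : der f ->
  exists ds : nat -> A, (forall i, ug i (ds i)) /\ f = \sum_(1 <= i < t.+1) ds i.
Proof.
move/lie_eltP/u_dec => [ds [dsP dsE]].
have lds i : lin_fun (ds i) by have [_ /(_ _ (dsP i))[]] := u_sub i.
exists (fun i => dual_of h (lds i)); split; first exact: dsP.
by apply: cvP => x; rewrite cv_sumE; exact: dsE.
Qed.

Lemma ug_dir (ds : nat -> A) : (forall i, ug i (ds i)) ->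
  \sum_(1 <= i < t.+1) ds i = 0 -> forall i, ds i = 0.
Proof.
move=> dsP ds0 i; apply: cvP => x; apply: (u_dir (ds := fun i => ds i)) => // y.
have := congr1 (fun f : A => f y) ds0; rewrite cv_sumE; exact.
Qed.

Lemma ug_br i j f g : ug i f -> ug j g -> ug (i + j)%N (f * g - g * f).
Proof. by move=> uf ug; exact: (u_br uf ug). Qed.

Lemma range_sum (V : zmodType) i (x : V) : ((i == 0)%N || (t < i)%N -> x = 0) ->
  \sum_(1 <= j < t.+1) (if j == i then x else 0) = x.
Proof.
move=> x0; have [/x0 ->|] := boolP ((i == 0)%N || (t < i)%N).
  by rewrite big1 // => j _; case: ifP.
rewrite negb_or -lt0n -leqNgt => /andP[i0 it].
rewrite (bigD1_seq i) ?iota_uniq ?mem_index_iota ?i0 ?ltnS //= eqxx big1 ?addr0 //.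
by move=> j /negPf ->.
Qed.

Lemma ug_comp i f (ds : nat -> A) : ug i f -> (forall j, ug j (ds j)) ->
  f = \sum_(1 <= j < t.+1) ds j -> forall j, ds j = if j == i then f else 0.
Proof.
move=> uf dsP fE j; apply/eqP; rewrite -subr_eq0; apply/eqP.
apply: (ug_dir (ds := fun j => ds j - (if j == i then f else 0))) => [l|].
  apply: subspaceB; [exact: ug_sub|exact: dsP|].
  by case: eqP => [->|_] //; case: (ug_sub l).
by rewrite sumrB -fE range_sum ?subrr // => /ug_zero; apply.
Qed.

Local Notation e1 := (euler char0 exh 1).

(** Along the one-parameter subgroup [exp (s d)], the function [y] has Taylor coefficients
    [(d ^+ r) y / r!]. The condition says that [y] is linear in exponential coordinates. *)
Definition linear_type (y : H) : Prop :=
  forall (d : A) r, der d -> r <> 1%N -> (d ^+ r) y = 0.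

Lemma euler_linear_type x : linear_type (e1 x).
Proof.
move=> d r dd r1; have := congr1 (fun f : A => f x) (der_exp_euler char0 exh r 1 dd).
by rewrite (introF eqP r1).
Qed.

(** By [eulerM] the image of [e1] is spanned by its values on algebra generators. The [z] are
    exponential coordinates on [U], and the [c] are derivations spanning its Lie algebra. *)
Lemma euler_coordinates : exists (m : nat) (z : nat -> H) (c : nat -> A),
  [/\ forall s, linear_type (z s), forall s, der (c s) &
      forall x, e1 x = \sum_(s < m) (c s x : k) *: z s].
Proof.
have [gens gensP] := aff.
have [m [z [phi [zP zE]]]] := finite_coordinates [seq e1 x | x <- gens].
exists m, z, (fun s => postcomp (dual_lin h (phi s)) e1); split.
- apply: zP.
    split=> [d r _ _|a x y hx hy d r dd r1]; first by rewrite linear0.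
    by rewrite linearP /= hx // hy // scaler0 addr0.
  by move=> _ /mapP[x _ ->]; exact: euler_linear_type.
- move=> s x y; rewrite !postcompE eulerM linearD !linearZ /=; congr (_ + _).
  exact: mulrC.
pose Q x := x = \sum_(s < m) phi s x *: z s.
have sQ : is_subspace Q.
  split; first by rewrite /Q big1 // => s _; rewrite linear0 scale0r.
  move=> a x y Qx Qy; rewrite /Q {1}Qx {1}Qy scaler_sumr -big_split.
  by apply: eq_bigr => s _; rewrite linearP scalerDl scalerA.
apply: (gensP (fun x => Q (e1 x))).
- split; first by rewrite linear0; case: sQ.
  by move=> a x y Qx Qy; rewrite linearP; case: sQ => _; apply.
- by rewrite euler1_1; case: sQ.
- by move=> x y Qx Qy; rewrite eulerM; apply: subspaceD => //; apply: subspaceZ.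
- by move=> x xg; apply: zE; apply: map_f.
Qed.

(** * Dilations of [H] attached to the grading of the Lie algebra *)

Section Dilation.
Variables (m : nat) (z : nat -> H) (c : nat -> A) (dc : nat -> nat -> A).
Hypothesis z_lin : forall s, linear_type (z s).
Hypothesis e1E : forall x, e1 x = \sum_(s < m) (c s x : k) *: z s.
Hypothesis dcP : forall s i, ug i (dc s i).
Hypothesis cE : forall s, c s = \sum_(1 <= i < t.+1) dc s i.

Lemma rank1_lin (f : A) (y : H) : linear (fun x => (f x : k) *: y).
Proof. by move=> a x x'; rewrite linearP scalerDl scalerA. Qed.
Definition rank1 (f : A) (y : H) : E := CVMap h _ (rank1_lin f y).

Definition ecomp (i : nat) : E := \sum_(s < m) rank1 (dc s i) (z s).
(** The logarithm of the dilation: [e1] with its component in [u i] scaled by [l ^+ i]. Derivations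
    composed with it undergo the same scaling, see [dil_ug]. *)
Definition edil (l : k) : E := \sum_(1 <= i < t.+1) l ^+ i *: ecomp i.
Definition dil (l : k) (d : A) : A := postcomp d (edil l).

Lemma postcomp_sumr (I : Type) (r : seq I) (F : I -> E) (d : A) :
  postcomp d (\sum_(i <- r) F i) = \sum_(i <- r) postcomp d (F i).
Proof. by apply: cvP => x; rewrite postcompE !cv_sumE linear_sum. Qed.

Lemma dilE l d : dil l d =
  \sum_(1 <= i < t.+1) l ^+ i *: \sum_(s < m) (d (z s) : k) *: dc s i.
Proof.
rewrite /dil /edil postcomp_sumr; apply: eq_bigr => i _.
rewrite postcompZr postcomp_sumr; congr (_ *: _); apply: eq_bigr => s _.
by apply: cvP => x; rewrite postcompE CVMapE linearZ cvZE; exact: mulrC.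
Qed.

Lemma der_coordinates d : der d -> d = \sum_(s < m) (d (z s) : k) *: c s.
Proof.
move=> dd; apply: cvP => x; rewrite -(der_euler char0 exh x dd) e1E linear_sum cv_sumE.
by apply: eq_bigr => s _; rewrite linearZ cvZE; exact: mulrC.
Qed.

Lemma dil_ug l i d : ug i d -> dil l d = l ^+ i *: d.
Proof.
move=> ud; pose dd j := \sum_(s < m) (d (z s) : k) *: dc s j.
have ddP j : ug j (dd j).
  apply: subspace_sum; first exact: ug_sub.
  by move=> s _ _; exact: subspaceZ (ug_sub j) (dcP s j).
have ddE : d = \sum_(1 <= j < t.+1) dd j.
  rewrite [LHS](der_coordinates (ug_der ud)) exchange_big; apply: eq_bigr => s _ /=.
  by rewrite -scaler_sumr -cE.
rewrite dilE -[RHS](@range_sum _ i).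
  apply: eq_bigr => j _; rewrite -/(dd j) (ug_comp ud ddP ddE).
  by case: eqP => [->|_] //; rewrite scaler0.
by move=> /ug_zero/(_ ud) ->; rewrite scaler0.
Qed.

Lemma dilP l a f g : dil l (a *: f + g) = a *: dil l f + dil l g.
Proof. by rewrite /dil postcompD postcompZ. Qed.

Lemma dil_lin l : linear (dil l). Proof. by move=> a f g; exact: dilP. Qed.
HB.instance Definition _ l := GRing.isLinear.Build k A A *:%R (dil l) (dil_lin l).

Lemma dil_der l d : der d -> der (dil l d).
Proof.
move=> dd; rewrite dilE; apply: subspace_sum; first exact: der_sub.
move=> i _ _; apply: (subspaceZ _ (der_sub h)); apply: subspace_sum; first exact: der_sub.
move=> s _ _; apply: (subspaceZ _ (der_sub h)); exact: ug_der (dcP s i).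
Qed.

Lemma dil_bracket l a b : der a -> der b ->
  dil l (a * b - b * a) = dil l a * dil l b - dil l b * dil l a.
Proof.
move=> /ug_dec[as_ [asP ->]] /ug_dec[bs [bsP ->]].
rewrite !linear_sum /= !big_distrlr /=.
rewrite [X in _ - X](exchange_big _ _ _ _) [X in _ = _ - X](exchange_big _ _ _ _) /=.
rewrite -!sumrB linear_sum; apply: eq_bigr => i _ /=.
rewrite -!sumrB linear_sum; apply: eq_bigr => j _ /=.
rewrite (dil_ug l (ug_br (asP i) (bsP j))) (dil_ug l (asP i)) (dil_ug l (bsP j)).
by rewrite -!scalerAl -!scalerAr !scalerA -exprD [l ^+ j * _]mulrC -exprD scalerBr.
Qed.

Lemma edil_one : edil 1 = e1.
Proof.
apply: cvP => x; rewrite e1E cv_sumE.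
under eq_bigr => i _ do rewrite cvZE expr1n scale1r cv_sumE.
rewrite exchange_big; apply: eq_bigr => s _ /=.
by rewrite cE cv_sumE scaler_suml.
Qed.

(** Since the [z] are of linear type, [d ^+ i] composed with [edil l] vanishes unless [i = 1]. Only
    splits with one letter on the left survive; their count builds up the [n!] that the exponential
    divides out. *)
Lemma der_exp_edil l d r n : der d ->
  postcomp (d ^+ r) (edil l ^+ n) = if r == n then (dil l d ^+ n) *+ n`! else 0.
Proof.
move=> dd; elim: n r => [|n IH] r.
  rewrite expr0 postcomp1 der_exp_1 //; case: r => [|r] /=; first by rewrite !expr0 scale1r.
  by rewrite exprS mul0r scale0r.
have de i : postcomp (d ^+ i) (edil l) = if i == 1%N then dil l d else 0.
  case: eqP => [->|i1]; first by rewrite expr1.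
  apply: cvP => x; rewrite postcompE cv0E /edil cv_sumE linear_sum big1 //= => j _.
  rewrite cvZE linearZ /= cv_sumE linear_sum /= big1 ?scaler0 // => s _.
  by rewrite CVMapE linearZ /= (z_lin s dd i1) scaler0.
rewrite exprS (coproduct_postcomp _ _ (der_exp_coproduct r dd)) big_map /=.
pose G i := dil l d * postcomp (d ^+ i) (edil l ^+ n).
rewrite (eq_bigr (fun q => if size q.1 == 1%N then G (size q.2) else 0)); last first.
  by move=> q _; rewrite de; case: eqP; rewrite // mul0r.
rewrite splits_size1 size_nseq /G IH; case: r => [|r] /=; first by rewrite mulr0n.
rewrite eqSS; case: eqP => [->|_]; last by rewrite mulr0 mul0rn.
by rewrite mulrnAr -exprS -mulrnA mulnC.
Qed.

Definition dilation (M : nat) (l : k) : E := \sum_(n < M.+1) (n`!)%:R^-1 *: edil l ^+ n.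

Lemma dilation_one M x : aug_null h M x -> dilation M 1 x = x.
Proof.
move=> hx; rewrite {2}(exp_euler char0 exh hx) /dilation cv_sumE edil_one.
by apply: eq_bigr => n _; rewrite cvZE.
Qed.

Lemma der_exp_dilation M l x d r : aug_null h M x -> der d ->
  (d ^+ r) (dilation M l x) = (dil l d ^+ r) x.
Proof.
move=> hx dd; rewrite /dilation cv_sumE linear_sum /=.
transitivity (\sum_(n < M.+1) if r == n then (dil l d ^+ r) x else 0).
  apply: eq_bigr => n _; rewrite cvZE linearZ /= -postcompE der_exp_edil //.
  case: eqP => [->|_]; last by rewrite cv0E scaler0.
  rewrite -scaler_nat cvZE scalerA mulVf ?natr_neq0 ?fact_gt0 //; exact: scale1r.
have [rM|Mr] := ltnP r M.+1.
  by rewrite (bigD1 (Ordinal rM)) //= eqxx big1 ?addr0 // => n;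
    rewrite -val_eqE /= eq_sym => /negPf ->.
(* Beyond the truncation both sides vanish, the right one because it has more than [M] factors
   vanishing at [1]. *)
rewrite big1 => [|n _]; last by rewrite gtn_eqF // (leq_trans (ltn_ord n)).
case: r Mr => // r; rewrite ltnS => Mr; rewrite -[in RHS](size_nseq r.+1 tt) -prod_const.
have := aug_null_leq Mr hx (w := nseq r.+1 (dil l d)); rewrite size_nseq => /(_ erefl) e.
rewrite -[in LHS]e; last first.
  by move=> f; rewrite mem_nseq => /andP[_ /eqP ->]; apply: der1; exact: dil_der.
by rewrite !big_nseq.
Qed.

(* Both sides are multilinear in the letters; swapping two adjacent letters
   changes them by the value on a shorter word, as [dil l] respects brackets.
   So by induction the difference is symmetric, and it vanishes on powers. *)
Lemma word_dilation M l x (w : seq A) : aug_null h M x -> (forall d, d \in w -> der d) ->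
  (\prod_(d <- w) d) (dilation M l x) = (\prod_(d <- w) dil l d) x.
Proof.
move=> hx; move: {2}(size w) (erefl (size w)) => r; elim: r w => [|r IH] w ws wP.
  by move/size0nil: ws => ->; rewrite !big_nil; exact: (der_exp_dilation l 0 hx (der_sub h).1).
pose G (v : seq A) : k := (\prod_(d <- v) d) (dilation M l x) - (\prod_(d <- v) dil l d) x.
suff : G w = 0 by rewrite /G => /eqP; rewrite subr_eq0 => /eqP.
apply: (symmetric_multilinear_eq0 char0 (r := r.+1) (G := G) (der_sub h)) => //.
- move=> s1 s2 a f g _ _ _ _ _; rewrite /G !big_cat !big_cons /= dilP.
  rewrite !mulrDl !mulrDr -!scalerAl -!scalerAr !cvDE !cvZE.
  set p1 := (_ * (f * _)) _; set p2 := (_ * (g * _)) _.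
  set p3 := (_ * (dil l f * _)) _; set p4 := (_ * (dil l g * _)) _.
  have sc (y : k^o) : a *: y = a * y :> k by [].
  rewrite !sc; move: (p1 : k) (p2 : k) (p3 : k) (p4 : k) => *; ring.
- move=> s1 s2 f g sz P1 P2 df dg; apply/eqP; rewrite -subr_eq0; apply/eqP.
  have -> : G (s1 ++ [:: f, g & s2]) - G (s1 ++ [:: g, f & s2]) = G (s1 ++ (f * g - g * f) :: s2).
    rewrite /G !big_cat !big_cons /= dil_bracket // !mulrBl !mulrBr !mulrA !cvDE !cvNE.
    set p1 := (_ * f * g * _) _; set p2 := (_ * g * f * _) _.
    set p3 := (_ * dil l f * dil l g * _) _; set p4 := (_ * dil l g * dil l f * _) _.
    move: (p1 : k) (p2 : k) (p3 : k) (p4 : k) => *; ring.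
  rewrite /G IH ?subrr //.
    by rewrite size_cat /= addnS; case: sz.
  move=> d; rewrite mem_cat inE => /or3P[/P1 //|/eqP ->|/P2 //].
  exact: der_bracket.
- move=> d dd; rewrite /G !big_nseq.
  have pw (f : A) n : iter n ( *%R f) 1 = f ^+ n.
    by elim: n => [|n IHn] //=; rewrite IHn exprS.
  by rewrite !pw (der_exp_dilation l _ hx dd) subrr.
Qed.

Lemma dilation_poly M x : exists p : {poly H}, forall l : k, dilation M l x = p.[l%:A].
Proof.
have edil_poly y : exists p : {poly H}, forall l : k, edil l y = p.[l%:A].
  exists (\sum_(1 <= i < t.+1) ecomp i y *: 'X^i) => l.
  rewrite horner_sum /edil cv_sumE; apply: eq_bigr => i _.
  by rewrite cvZE hornerZ hornerXn exprZn expr1n mulr_algr.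
have /choice[q qE] := edil_poly.
have exp_poly n y : exists p : {poly H}, forall l : k, (edil l ^+ n) y = p.[l%:A].
  elim: n y => [|n IH] y; first by exists ((eps y)%:A%:P) => l; rewrite hornerC cv1E.
  have /choice[q' q'E] := IH.
  exists (\sum_(p <- D y) q p.1 * q' p.2) => l; rewrite exprS cvME horner_sum.
  by apply: eq_bigr => p _; rewrite hornerM qE q'E.
have /choice[q' q'E] := fun n => exp_poly n x.
exists (\sum_(n < M.+1) ((n`!)%:R^-1 : k)%:A *: q' n) => l.
rewrite horner_sum /dilation cv_sumE; apply: eq_bigr => n _.
by rewrite cvZE hornerZ mulr_algl q'E.
Qed.

(** Degrees are carried as tags because a functional does not determine its degree: zero lies in
    every [u i]. *)
Definition hword (w : seq (nat * A)) : Prop := forall p, p \in w -> ug p.1 p.2.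
Definition hdeg (w : seq (nat * A)) : nat := \sum_(p <- w) p.1.
Definition hval (w : seq (nat * A)) : A := \prod_(p <- w) p.2.

Lemma hword_dilation M l x w : aug_null h M x -> hword w ->
  hval w (dilation M l x) = l ^+ hdeg w *: hval w x.
Proof.
move=> hx hw; have := @word_dilation M l x [seq p.2 | p <- w] hx.
rewrite !big_map => ->; last by move=> d /mapP[p /hw up ->]; exact: ug_der up.
rewrite -cvZE; congr (cvfun _ x); rewrite /hval /hdeg.
elim: w hw => [|p w IH] hw; first by rewrite !big_nil expr0 scale1r.
rewrite !big_cons IH => [|q qw]; last by apply: hw; rewrite inE qw orbT.
rewrite (dil_ug l (hw p (mem_head _ _))) exprD.
by rewrite -scalerAl -scalerAr scalerA.
Qed.

(** The components are the coefficients, in the parameter, of the dilation of [x]. Parameter [1]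
    returns [x], and a word of weight [j] sees only the coefficient of index [j]. *)
Lemma homogeneous_components x : exists p : {poly H},
  x = \sum_(j < size p) p`_j /\
  forall w j, hword w -> hval w p`_j = if j == hdeg w then hval w x else 0.
Proof.
have [M hx] := exh x; have [p pE] := dilation_poly M x; exists p; split.
  rewrite -{1}(dilation_one hx) pE scale1r horner_coef.
  by apply: eq_bigr => j _; rewrite expr1n mulr1.
move=> w j hw; pose q := \poly_(i < size p) (hval w p`_i : k).
have qE : q = (hval w x : k) *: 'X^(hdeg w).
  apply/eqP; rewrite -subr_eq0; apply/eqP/(poly_nat_eq0 char0) => n.
  rewrite hornerD hornerN hornerZ hornerXn horner_poly; apply/eqP; rewrite subr_eq0; apply/eqP.
  have := hword_dilation n%:R hx hw; rewrite pE horner_coef linear_sum /= => e.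
  rewrite mulrC -[RHS]e; apply: eq_bigr => i _.
  by rewrite exprZn expr1n mulr_algr linearZ /= mulrC.
have := congr1 (fun r : {poly k} => r`_j) qE; rewrite coef_poly coefZ coefXn.
case: ltnP => [_ ->|sz]; first by case: eqP; rewrite ?mulr1 // mulr0.
by rewrite nth_default // linear0; case: eqP => _ //=; rewrite mulr1.
Qed.

(** [x] is the sum of the [e1 ^+ r] at [x] over factorials, and expanding each [e1] into the
    [dc s i] writes these through words evaluated at [x]. *)
Lemma hword_separate x : (forall w, hword w -> hval w x = 0) -> x = 0.
Proof.
move=> hx; have [M aM] := exh x.
rewrite (exp_euler char0 exh aM) big1 // => r _.
suff -> : (e1 ^+ r) x = 0 by rewrite scaler0.
elim: (val r) x {aM} hx => [|n IH] x hx.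
  by have := hx [::]; rewrite /hval big_nil cv1k cv1E => -> //; rewrite scale0r.
rewrite exprSr cvME.
transitivity (\sum_(s < m) \sum_(1 <= i < t.+1) (e1 ^+ n) (rtrans (dc s i) x) * z s).
  under [RHS]eq_bigr => s _.
    under eq_bigr => i _ do rewrite /rtrans /dsum linear_sum mulr_suml.
    rewrite exchange_big /=; over.
  rewrite exchange_big /=; apply: eq_bigr => p _; rewrite e1E mulr_sumr.
  apply: eq_bigr => s _; rewrite cE cv_sumE scaler_suml mulr_sumr.
  by apply: eq_bigr => i _; rewrite linearZ /= -scalerAl -scalerAr.
rewrite big1 // => s _; rewrite big1 // => i _; rewrite IH ?mul0r // => w hw.
rewrite cv_rtrans; have := hx (rcons w (i, dc s i)); rewrite /hval big_rcons /=; apply.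
move=> p; rewrite mem_rcons inE => /orP[/eqP ->|/hw //]; exact: dcP.
Qed.

(** * The grading of [H] by weights of words *)

Definition comp_space (j : nat) (x : H) : Prop :=
  forall w, hword w -> hdeg w <> j -> hval w x = 0.

Lemma comp_space_decomp : direct_decomp comp_space.
Proof.
split.
- move=> i; split=> [w _ _|a x y hx hy w hw dw]; first by rewrite linear0.
  by rewrite linearP /= hx // hy // scaler0 addr0.
- move=> x; have [p [xE pP]] := homogeneous_components x.
  exists (size p), (fun j => p`_j); split=> // j w hw dw.
  by rewrite pP // eq_sym (introF eqP dw).
- move=> N xs xsP xs0 i iN; apply: hword_separate => w hw.
  have [e|/eqP dw] := eqVneq (hdeg w) i; last exact: xsP.
  have := congr1 (hval w) xs0; rewrite linear_sum linear0 (bigD1 (Ordinal iN)) //= big1 ?addr0 //.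
  move=> j ji; apply: xsP => // e'; move: ji; rewrite -val_eqE /= -e' e eqxx //.
Qed.

Lemma hword_homogeneous w : hword w -> homogeneous (h := h) comp_space (hdeg w) (hval w).
Proof. by move=> hw j x jw hx; apply: hx => // e; apply: jw. Qed.

Lemma hword_cat w1 w2 : hword w1 -> hword w2 ->
  [/\ hword (w1 ++ w2), hdeg (w1 ++ w2) = (hdeg w1 + hdeg w2)%N &
      hval (w1 ++ w2) = hval w1 * hval w2].
Proof.
move=> h1 h2; split; [|by rewrite /hdeg big_cat|by rewrite /hval big_cat].
by move=> p; rewrite mem_cat => /orP[/h1|/h2].
Qed.

Lemma hval_coproduct w : hword w ->
  coproduct (hval w) [seq (hval l.1, hval l.2) | l <- splits w].
Proof.
move=> hw; apply: (coproduct_word (g := snd)) => p /hw; exact: ug_der.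
Qed.

Lemma hword_splits w l : hword w -> l \in splits w ->
  [/\ hword l.1, hword l.2 & (hdeg l.1 + hdeg l.2)%N = hdeg w].
Proof.
move=> hw lw; have [s1 s2] := splits_sub lw.
split; [by move=> p /s1/hw|by move=> p /s2/hw|exact: splits_weight].
Qed.

Lemma comp_space_mul i j x y : comp_space i x -> comp_space j y -> comp_space (i + j)%N (x * y).
Proof.
move=> hx hy w hw dw; rewrite (hval_coproduct hw) big_map big_seq big1 // => l lw /=.
have [h1 h2 e] := hword_splits hw lw.
have [e1'|/eqP d1] := eqVneq (hdeg l.1) i; last by rewrite hx // mul0r.
rewrite hy ?mulr0 // => e2; apply: dw; by rewrite -e e1' e2.
Qed.

Lemma comp_space_coproduct i x : comp_space i x ->
  in_tensor (fun a b => exists l, (l <= i)%N /\ comp_space l a /\ comp_space (i - l)%N b) (D x).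
Proof.
move=> hx; have [pr [pl pP ps pE]] := graded_projections comp_space_decomp.
(* The part of the coproduct of total degree [i]; it remains to see that nothing was lost. *)
pose t1 := [seq (pr (l : 'I_i.+1) p.1, pr (i - l)%N p.2) | p <- D x, l <- enum 'I_i.+1].
exists t1; split; last first.
  move=> q /allpairsP[[p l] /= [_ _ ->]] /=; exists (l : nat).
  by rewrite -ltnS ltn_ord; split=> //; split; exact: pP.
have hpr w j y : hword w -> hval w (pr j y) = if j == hdeg w then hval w y else 0.
  move=> hw; have [jw|/eqP jw] := eqVneq j (hdeg w); last first.
    by apply: (pP j y) => // e; apply: jw.
  have [N /(_ (maxn N j.+1) (leq_maxl _ _)) yE] := ps y.
  have lt : (j < maxn N j.+1)%N by rewrite leq_max ltnSn orbT.
  rewrite [in RHS]yE linear_sum (bigD1 (Ordinal lt)) //= big1 ?addr0 // => l lj.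
  by apply: (pP l y) => // e; case/eqP: lj; apply: val_inj; exact: esym (etrans jw e).
have words_eq w1 w2 : hword w1 -> hword w2 ->
    \sum_(p <- t1) hval w1 p.1 * hval w2 p.2 = (hval w1 * hval w2) x.
  move=> h1 h2; rewrite big_allpairs_dep /=.
  rewrite (eq_bigr (fun p => if (hdeg w1 + hdeg w2 == i)%N then hval w1 p.1 * hval w2 p.2 else 0)).
    have [e|/eqP ne] := eqVneq (hdeg w1 + hdeg w2)%N i; first by rewrite cvME.
    by rewrite big1 //; have [c1 c2 <-] := hword_cat h1 h2; rewrite hx // c2.
  move=> p _; rewrite big_enum /=.
  rewrite (eq_bigr (fun l : 'I_i.+1 => if (l == hdeg w1 :> nat) && (i - l == hdeg w2)%N
      then hval w1 p.1 * hval w2 p.2 else 0)); last first.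
    by move=> l _; rewrite !hpr //; do 2!case: eqP => _; rewrite ?mul0r ?mulr0.
  have [e|ne] := boolP (hdeg w1 + hdeg w2 == i)%N.
    have lt : (hdeg w1 < i.+1)%N by rewrite ltnS -(eqP e) leq_addr.
    have e' : (i - hdeg w1 = hdeg w2)%N by rewrite -(eqP e) addKn.
    rewrite (bigD1 (Ordinal lt)) //= e' !eqxx big1 ?addr0 // => l.
    by rewrite -val_eqE /= => /negPf ->.
  rewrite big1 // => l _; case: andP => // -[/eqP e1' /eqP e2'].
  by case/negP: ne; rewrite -e1' -e2' subnKC // -ltnS ltn_ord.
apply: (tensor_eqP (h := h)) => f g; rewrite -[RHS](cvME f g).
(* Agreement on pairs of words spreads one leg at a time: with a word on the right, words separate
   the left leg ([trw]); then, with any [f] on the left, words separate the right leg. *)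
pose tl (f : A) : H := \sum_(p <- t1) (f p.1 : k) *: p.2.
pose tr (g : A) : H := \sum_(p <- t1) (g p.2 : k) *: p.1.
have tlE (f' g' : A) : g' (tl f') = \sum_(p <- t1) f' p.1 * g' p.2.
  by rewrite /tl linear_sum; apply: eq_bigr => p _; rewrite linearZ.
have trE (f' g' : A) : f' (tr g') = \sum_(p <- t1) f' p.1 * g' p.2.
  by rewrite /tr linear_sum; apply: eq_bigr => p _; rewrite linearZ; exact: mulrC.
have trw w2 : hword w2 -> tr (hval w2) = rtrans (hval w2) x.
  move=> h2; apply/eqP; rewrite -subr_eq0; apply/eqP/hword_separate => w1 h1.
  by rewrite linearB /= trE words_eq // cv_rtrans subrr.
have -> : \sum_(p <- t1) f p.1 * g p.2 = g (tl f) by rewrite tlE.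
rewrite -cv_ltrans; congr (cvfun g _).
apply/eqP; rewrite -subr_eq0; apply/eqP/hword_separate => w2 h2.
by rewrite linearB /= tlE -trE trw // cv_rtrans cv_ltrans subrr.
Qed.

(** Reading [S * id = 1] through a word expresses that word after [S] by shorter words after [S], so
    homogeneity follows by induction on length. *)
Lemma comp_space_antipode i x : comp_space i x -> comp_space i (S x).
Proof.
suff main n w : (size w <= n)%N -> hword w ->
    homogeneous (h := h) comp_space (hdeg w) (postcomp (hval w) (cvS h)).
  move=> hx w hw dw; exact: (main (size w) w (leqnn _) hw i x (fun e => dw (esym e)) hx).
elim: n w {i x} => [|n IH] w.
  rewrite leqn0 size_eq0 => /eqP -> _.
  have := coproduct_postcomp (cvS h) (cvid h) (coproduct_one h).
  rewrite big_seq1 /= cvS_id postcomp_id mulr1 postcomp1 cv1k (eps1 h) scale1r.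
  rewrite /hval big_nil => <-; have hn : hword [::] by [].
  by have := hword_homogeneous hn; rewrite /hval big_nil.
move=> wn hw j x jw hx; have [r [rE rP]] := splits_head w.
have := coproduct_postcomp (cvS h) (cvid h) (hval_coproduct hw).
have v0 : hval [::] = 1 by rewrite /hval big_nil.
rewrite big_map rE big_cons /= v0 postcomp_id mulr1 cvS_id postcomp1.
move/(congr1 (fun f : A => f x)); rewrite cvDE cv_sumE big_seq.
rewrite [X in _ + X]big1 ?addr0 => [<-|l lr].
  rewrite cvZE; case: w hw jw {wn rE rP} => [|p w] hw jw.
    have /(_ j x) := hword_homogeneous hw; rewrite /hval big_nil => -> //.
    by rewrite scaler0.
  by rewrite /hval big_cons cvM_1 (der1 (ug_der (hw p (mem_head _ _)))) mul0r scale0r.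
have lw : l \in splits w by rewrite rE inE lr orbT.
have [h1 h2 e] := hword_splits hw lw.
have ln : (size l.1 <= n)%N by rewrite -ltnS (leq_trans _ wn) //; exact: (allP rP l lr).
have := homogeneousM comp_space_coproduct (IH l.1 ln h1) (hword_homogeneous h2).
by rewrite e postcomp_id => hh; exact: (hh j x jw hx).
Qed.

(* Iterated brackets of derivations of degree one witness that the component of
   degree [i] lies in the [i]-th power of the augmentation ideal. *)
Lemma lie_components_kill f : lie_elt eps f -> exists ds : nat -> A,
  [/\ forall i, ug i (ds i), forall i, kills i (ds i) &
      f = ((\sum_(1 <= i < t.+1) ds i : A) : H -> k)].
Proof.
move: f; apply: u_gen.
- split.
    exists (fun=> 0); split=> [i|i|]; [by case: (ug_sub i)|by case: (kills_sub h i)|].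
    by rewrite big1.
  move=> a _ _ [d1 [u1 k1 ->]] [d2 [u2 k2 ->]].
  exists (fun i => a *: d1 i + d2 i); split=> [i|i|].
  + by case: (ug_sub i) => _; apply.
  + by case: (kills_sub h i) => _; apply.
  + by rewrite big_split -scaler_sumr.
- move=> _ _ [d1 [u1 k1 ->]] [d2 [u2 k2 ->]].
  pose br i j : A := d1 i * d2 j - d2 j * d1 i.
  (* Collects the brackets of total degree [l]. Those of degree above [t] lie in a zero space, so
     stopping at [t] loses nothing. *)
  pose fs l : A := \sum_(1 <= i < t.+1) \sum_(1 <= j < t.+1)
    (if l == (i + j)%N then br i j else 0).
  have brk i j : kills (i + j) (br i j).
    apply: subspaceB; [exact: kills_sub|exact: killsM|].
    by rewrite addnC; exact: killsM.
  exists fs; split=> [l|l|].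
  + apply: subspace_sum; first exact: ug_sub.
    move=> i _ _; apply: subspace_sum; first exact: ug_sub.
    by move=> j _ _; case: eqP => [->|_]; [exact: ug_br|case: (ug_sub l)].
  + apply: subspace_sum; first exact: kills_sub.
    move=> i _ _; apply: subspace_sum; first exact: kills_sub.
    by move=> j _ _; case: eqP => [->|_]; [exact: brk|case: (kills_sub h l)].
  + transitivity (cvfun ((\sum_(1 <= i < t.+1) d1 i) * (\sum_(1 <= i < t.+1) d2 i) -
        (\sum_(1 <= i < t.+1) d2 i) * (\sum_(1 <= i < t.+1) d1 i))); first by [].
    apply: (congr1 (fun f : A => f : H -> k)).
    rewrite !big_distrlr /= [X in _ - X](exchange_big _ _ _ _) /= -sumrB.
    rewrite /fs exchange_big; apply: eq_bigr => i _ /=.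
    rewrite -sumrB exchange_big; apply: eq_bigr => j _ /=.
    rewrite range_sum // => /ug_zero; apply; exact: ug_br.
- move=> f uf; have [_ /(_ f uf)[lf df]] := u_sub 1.
  pose d : A := dual_of h lf; have ud : ug 1 d by exact: uf.
  exists (fun i => if i == 1%N then d else 0); split=> [i|i|].
  + by case: eqP => [->|_] //; case: (ug_sub i).
  + case: eqP => [-> x /aug_null0 ->|_]; last by case: (kills_sub h i).
    by rewrite linearZ /= (der1 (ug_der ud)) scaler0.
  + by rewrite range_sum // => /ug_zero; apply.
Qed.

Lemma ug_kills i d : ug i d -> kills i d.
Proof.
move=> ud; have [] := lie_components_kill (f := d); first exact/lie_eltP/(ug_der ud).
move=> ds [dsu dsk dE].
have dE' : d = \sum_(1 <= j < t.+1) ds j by apply: cvP => x; rewrite dE.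
by have := ug_comp ud dsu dE' i; rewrite eqxx => <-.
Qed.

Lemma hword_kills w : hword w -> kills (hdeg w) (hval w).
Proof.
elim: w => [|p w IH] hw; first by rewrite /hdeg big_nil.
rewrite /hdeg /hval !big_cons; apply: killsM.
  by apply: ug_kills; apply: hw; rewrite mem_head.
by apply: IH => q qw; apply: hw; rewrite inE qw orbT.
Qed.

Lemma comp_space0 x : comp_space 0 x -> x = (eps x)%:A.
Proof.
move=> hx; apply/eqP; rewrite -subr_eq0; apply/eqP/hword_separate => -[|p w] hw.
  by rewrite /hval big_nil linearB /= !cv1k (epsA h) subrr.
rewrite linearB /= linearZ /= [hval _ 1](_ : _ = 0) ?scaler0 ?subr0; last first.
  by rewrite /hval big_cons cvM_1 (der1 (ug_der (hw p (mem_head _ _)))) mul0r.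
have [p0|p0] := posnP p.1; last first.
  by apply: hx => //; rewrite /hdeg big_cons => /eqP; rewrite addn_eq0 gtn_eqF.
rewrite /hval big_cons (_ : p.2 = 0) ?mul0r //.
by apply: (ug_zero (i := p.1)); [rewrite p0|apply: hw; rewrite mem_head].
Qed.

(** In each term of the coproduct either the left degree is at most [n], and induction applies, or
    the right degree is zero and that leg is a scalar. *)
Lemma comp_space_corad_filt n j x : (j <= n)%N -> comp_space j x -> corad_filt D n x.
Proof.
elim: n j x => [|n IH] j x.
  by rewrite leqn0 => /eqP -> /comp_space0 ->; apply/conn; exists (eps x).
move=> jn hx /=; have [s [se sP]] := comp_space_coproduct hx.
exists s; split=> // p /sP[l [lj [h1 h2]]].
have [ln|nl] := leqP l n; first by right; exact: IH h1.
left; apply/conn; exists (eps p.2); apply: comp_space0.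
by rewrite (_ : (j - l)%N = 0%N) // in h2; apply/eqP; rewrite subn_eq0 (leq_trans jn).
Qed.

Lemma corad_filt_sum n (I : eqType) (r : seq I) (F : I -> H) : (forall i, corad_filt D n (F i)) ->
  corad_filt D n (\sum_(i <- r) F i).
Proof.
case: n => [|n] FP.
  have /choice[b bP] : forall i, exists c : k, F i = c%:A by move=> i; apply/conn; exact: (FP i).
  apply/conn; exists (\sum_(i <- r) b i); rewrite scaler_suml.
  by apply: eq_bigr => i _; exact: bP.
have /choice[s sP] := FP.
exists (flatten [seq s i | i <- r]); split.
  apply: (tensor_eqP (h := h)) => f g; rewrite -[RHS](cvME f g) linear_sum big_flatten big_map.
  apply: eq_bigr => i _; have [e _] := sP i.
  exact: (tensor_bilin (bilinM f g) e).
move=> p /flattenP[_ /mapP[i _ ->] /(proj2 (sP i))] //.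
Qed.

Theorem comp_space_coradically_graded : coradically_graded D S.
Proof.
exists comp_space; split.
  split; [exact: comp_space_decomp|exact: comp_space_mul|exact: comp_space_antipode|].
  exact: comp_space_coproduct.
move=> n x; split=> [/(corad_filt_aug_null (h := h) conn) hx|[xs [xsP ->]]]; last first.
  by apply: corad_filt_sum => j; apply: comp_space_corad_filt (xsP j); rewrite -ltnS.
have [p [xE pP]] := homogeneous_components x.
exists (fun j => p`_j); split=> [j w hw dw|].
  by rewrite pP // eq_sym (introF eqP dw).
(* A word of weight [j > n] lies in the [j]-th power of the augmentation ideal, up to double
   annihilator, and so vanishes at [x]. *)
have big j : (n < j)%N -> p`_j = 0.
  move=> nj; apply: hword_separate => w hw; rewrite pP //; case: eqP => // e.
  have := hword_kills hw; rewrite -e; case: (j) nj => // j' nj; apply.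
  exact: aug_null_leq hx.
have wide a b : (forall j, (a <= j)%N -> p`_j = 0) -> (a <= b)%N ->
    \sum_(j < a) p`_j = \sum_(j < b) p`_j.
  move=> Fa ab; rewrite (big_ord_widen b (fun j => p`_j) ab) big_mkcond.
  by apply: eq_bigr => i _; case: ltnP => // /Fa.
rewrite [LHS]xE (wide (size p) (maxn (size p) n.+1)) ?leq_maxl //; last first.
  by move=> j sj; rewrite nth_default.
by rewrite -(wide n.+1) ?leq_maxr.
Qed.

End Dilation.

End CarnotToGraded.

Theorem carnot_coradically_graded (k : closedFieldType) (H : comAlgType k)
    (D : H -> seq (H * H)) (eps : H -> k) (S : H -> H) :
  [pchar k] =i pred0 -> is_hopf D eps S -> affine_alg H -> connected D ->
  carnot D eps -> coradically_graded D S.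
Proof.
move=> char0 h aff conn [t [u [u1 [u2 [u3 [u4 [u5 u6]]]]]]].
have exh := aug_null_exhaustive h conn.
have [m [z [c [zl cd cE]]]] := euler_coordinates char0 exh aff.
have /choice[dc dcP] : forall s, exists ds : nat -> cvmap k^o h,
    (forall i, ug u i (ds i)) /\ c s = \sum_(1 <= i < t.+1) ds i.
  by move=> s; apply: ug_dec.
exact: (comp_space_coradically_graded conn u1 u2 u3 u4 u5 u6 zl cE
  (fun s => (dcP s).1) (fun s => (dcP s).2)).
Qed.

Theorem theorem1p6 (k : closedFieldType) (H : comAlgType k)
    (D : H -> seq (H * H)) (eps : H -> k) (S : H -> H) :
  [pchar k] =i pred0 ->
  is_hopf D eps S ->
  affine_alg H ->
  connected D ->
  (coradically_graded D S <-> carnot D eps).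
Proof.
move=> char0 h aff conn; split; first exact: coradically_graded_carnot.
exact: carnot_coradically_graded.
Qed.
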